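(* Let $l\in L(\kappa)$ be regular, let $T\in[V_\kappa\otimes V_\gamma]^M$ with $\|T\|=1$, and let $\sigma_T$ be the state on $A_\gamma$ associated to $T$ and to an $l$-conveniently arranged sequence of unitary embeddings $\xi_n:H^{\kappa,i\lambda_n}\to L^2(\Gamma\backslash G)$. Then the sequence of states $\sigma_{\xi_n(\psi_T)}$ on $A_\gamma^K$ has a weak limit, which is given by the restriction of $\sigma_T$ from $A_\gamma$ to $A_\gamma^K$.
   Context: Setting. $G$ is a semisimple Lie group, $K\subset G$ a maximal compact subgroup, $\Gamma\subset G$ a cocompact torsion-free discrete subgroup; $\Gamma\backslash G$ carries a $G$-invariant measure and $K$ the Haar measure of total mass $1$. $G=KAN$, $g=k(g)a(g)n(g)$, is an Iwasawa decomposition; $M=Z_K(A)$; $\mathfrak{a},\mathfrak{n}$ are the Lie algebras of $A,N$; $\rho(H)=\frac12\mathrm{Tr}(\mathrm{ad}(H)|_{\mathfrak n})$; $a^\nu=\exp(\nu(\log a))$. $(\gamma,V_\gamma)$ is a finite-dimensional unitary representation of $K$ and $(\kappa,V_\kappa)$ an irreducible unitary representation of $M$. $A_\gamma=C(\Gamma\backslash G)\otimes\mathrm{End}(V_\gamma)$. Inner products are antilinear in the first variable. $A_\gamma^K\subset A_\gamma$ is the subalgebra of $K$-invariants, i.e. of $f$ with $\gamma(k)f(\Gamma gk)\gamma(k)^{-1}=f(\Gamma g)$ for all $k\in K$ (sections of the endomorphism bundle of $\Gamma\backslash G\times_KV_\gamma$). For a unit vector $u\in L^2(\Gamma\backslash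 G\times_KV_\gamma)=[L^2(\Gamma\backslash G)\otimes V_\gamma]^K$, $\sigma_u(f)=\int_{\Gamma\backslash G}\langle u(\Gamma g),f(\Gamma g)u(\Gamma g)\rangle$. Principal series. For $\lambda\in\mathfrak{a}^*$, $H^{\kappa,i\lambda}=L^2(K\times_MV_\kappa)$ is the space of $L^2$-functions $\phi:K\to V_\kappa$ with $\phi(km)=\kappa(m)^{-1}\phi(k)$, with the unitary $G$-action $(\pi^{\kappa,i\lambda}(g)\phi)(k)=\phi(k(g^{-1}k))\,a(g^{-1}k)^{i\lambda-\rho}$. $C^K(K\times_MV_\kappa)$ is its subspace of $K$-finite vectors. Functionals. A unitary embedding $\xi:H^{\kappa,i\lambda}\to L^2(\Gamma\backslash G)$ is an isometric $G$-map (for right translation); we write $\xi$ also for $\xi\otimes\mathrm{id}_{V_\gamma}$. For smooth $\phi,\psi\in H^{\kappa,i\lambda}_\infty\otimes V_\gamma$ and $f\in A_\gamma$ put $\sigma^\xi_{\phi,\psi}(f)=\int_{\Gamma\backslash G}\langle\xi(\phi)(\Gamma g),f(\Gamma g)\xi(\psi)(\Gamma g)\rangle$. $A_{\gamma,K}\subset A_\gamma$ is the subalgebra of elements that are $K$-finite under right translation. Convenient sequences. The Weyl group $N_K(A)/M$ acts on $\mathfrak a^*$; $\lambda\in\mathfrak a^*$ is regular if it is fixed by no nontrivial Weyl group element. $S(\mathfrak a^* )=(\mathfrak a^*\setminus\{0\})/\mathbb R^+$ is the space of rays, identified with the unit sphere of $\mathfrak a^*$ for the Killing form metric; $[\lambda]$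 is the ray of $\lambda$. $L(\kappa)\subset S(\mathfrak a^* )$ is the set of $l$ for which there are unitary embeddings $\xi_n:H^{\kappa,i\lambda_n}\to L^2(\Gamma\backslash G)$ with $\lambda_n\to\infty$, $[\lambda_n]\to l$. Such a sequence is $l$-conveniently arranged if all $\lambda_n$ are regular and for all $\phi,\psi\in C^K(K\times_MV_\kappa)\otimes V_\gamma$ the functionals $\sigma^{\xi_n}_{\phi,\psi}$ on $A_\gamma$ converge weakly; the limit is denoted $\sigma_{\phi,\psi}$. The state $\sigma_T$. For $T\in[V_\kappa\otimes V_\gamma]^M$, $\psi_T(k)=(1\otimes\gamma(k))T$ defines an element of $[C^\infty(K\times_MV_\kappa)\otimes V_\gamma]^K$, and $\delta_T$ is the distribution $\phi\mapsto\langle T,\phi(1)\rangle$. For $\mu\in\hat K$ let $\delta_{T,\mu}$ be its $\mu$-isotypic component, i.e. the unique element of the ($\mu$-isotypic subspace of $C^{-\infty}(K\times_MV_\kappa)$)$\,\otimes V_\gamma$ with $\langle\delta_{T,\mu},\phi\rangle=\langle T,\phi(1)\rangle$ for all $\phi$ in this finite-dimensional space. For $f\in A_{\gamma,K}$ put $\sigma_T(f)=\sum_{\mu\in\hat K}\sigma_{\psi_T,\delta_{T,\mu}}(f)$ (a finite sum). The functional $\sigma_T$ extends continuously to a state on $A_\gamma$, also denoted $\sigma_T$. *)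

(* Defs.v *)
From HB Require Import structures.
From mathcomp Require Import all_boot all_order all_algebra spectral.
From mathcomp Require Import complex.
From mathcomp Require Import all_classical all_reals all_analysis.

Set Warnings "-redundant-canonical-projection".

Set Implicit Arguments.
Unset Strict Implicit.
Unset Printing Implicit Defensive.

Import Order.TTheory GRing.Theory Num.Theory numFieldNormedType.Exports.

Local Open Scope classical_set_scope.
Local Open Scope quotient_scope.
Local Open Scope ring_scope.

Notation borel T := (g_sigma_algebraType (@open T)).

HB.mixin Record isTopologicalGroup G of PointedTopological G & Group G := {
  mulg_continuous : continuous (fun x : G * G => (x.1 * x.2)%g) ;
  invg_continuous : continuous (fun x : G => (x^-1)%g)
}.

#[short(type="topologicalGroupType")]
HB.structure Definition TopologicalGroup :=
  {G of PointedTopological G & Group G & isTopologicalGroup G}.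

Section Subgroups.
Variable G : topologicalGroupType.
Implicit Types H : set G.

Definition is_subgroup H : Prop :=
  [/\ H 1%g, (forall x y, H x -> H y -> H (x * y)%g)
    & (forall x, H x -> H (x^-1)%g)].

Definition maximal_compact_subgroup H : Prop :=
  [/\ is_subgroup H, compact H
    & forall H', is_subgroup H' -> compact H' -> H `<=` H' -> H' = H].

Definition discrete_subgroup H : Prop :=
  is_subgroup H /\ exists2 U, nbhs (1%g : G) U & U `&` H = [set 1%g].

Definition torsion_free H : Prop :=
  forall x (m : nat), H x -> (0 < m)%N -> (x ^+ m)%g = 1%g -> x = 1%g.

Definition right_coset H (x : G) : set G := [set (h * x)%g | h in H].

Definition coset_rel H (x y : G) : bool :=
  `[< right_coset H x = right_coset H y >].

Lemma coset_rel_refl H : reflexive (coset_rel H).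
Proof. by move=> x; apply/asboolP. Qed.

Lemma coset_rel_sym H : symmetric (coset_rel H).
Proof. by move=> x y; apply/asboolP/asboolP. Qed.

Lemma coset_rel_trans H : transitive (coset_rel H).
Proof. by move=> y x z /asboolP xy /asboolP yz; apply/asboolP; rewrite xy. Qed.

Canonical coset_equiv H :=
  EquivRel (coset_rel H) (coset_rel_refl H) (coset_rel_sym H)
    (@coset_rel_trans H).

Definition coset_space H : Type :=
  quotient_topology {eq_quot (coset_equiv H)}.

HB.instance Definition _ H := PointedTopological.on (coset_space H).
HB.instance Definition _ H := Quotient.on (coset_space H).

Definition coset_of_elt H (g : G) : coset_space H :=
  (\pi_(coset_space H) g)%qT.

(* Right translation [H x |-> H x g] on [H \ G]. *)
Definition coset_act H (x : coset_space H) (g : G) : coset_space H :=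
  coset_of_elt H (repr x * g)%g.

End Subgroups.

Section Smooth.
Variable R : realType.

Fixpoint Ck_on (V W : normedModType R) (k : nat) (U : set V) (f : V -> W)
    : Prop :=
  (forall x, U x -> {for x, continuous f}) /\
  if k is k'.+1 then
    (forall x v, U x -> derivable f x v) /\
    (forall v, Ck_on k' U (fun x => 'D_v f x))
  else True.

Definition smooth_on (V W : normedModType R) (U : set V) (f : V -> W) : Prop :=
  forall k, Ck_on k U f.

Record chart (G : topologicalType) (n : nat) := Chart {
  chart_dom : set G ;
  chart_fun : G -> 'rV[R]_n ;
  chart_inv : 'rV[R]_n -> G ;
  chart_dom_open : open chart_dom ;
  chart_im_open : open (chart_fun @` chart_dom) ;
  chart_funK : forall g, chart_dom g -> chart_inv (chart_fun g) = g ;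
  chart_fun_continuous :
    forall g, chart_dom g -> {for g, continuous chart_fun} ;
  chart_inv_continuous :
    forall g, chart_dom g -> {for chart_fun g, continuous chart_inv}
}.

(* [base_chart] is an auxiliary choice: it identifies the tangent space at 1,
   i.e. the Lie algebra, with ['rV_n]. *)
Record lie_structure (G : topologicalGroupType) (n : nat) := LieStructure {
  lie_hausdorff : hausdorff_space G ;
  lie_second_countable : @second_countable G ;
  atlas : set (chart G n) ;
  atlas_cover : forall g, exists2 c, atlas c & chart_dom c g ;
  atlas_compatible : forall c c', atlas c -> atlas c' ->
    smooth_on (chart_fun c @` (chart_dom c `&` chart_dom c'))
      (chart_fun c' \o chart_inv c) ;
  lie_mul_smooth : forall c1 c2 c3, atlas c1 -> atlas c2 -> atlas c3 ->
    smooth_on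
      [set xy : 'rV[R]_n * 'rV[R]_n |
        [/\ (chart_fun c1 @` chart_dom c1) xy.1,
            (chart_fun c2 @` chart_dom c2) xy.2
          & chart_dom c3 (chart_inv c1 xy.1 * chart_inv c2 xy.2)%g]]
      (fun xy => chart_fun c3 (chart_inv c1 xy.1 * chart_inv c2 xy.2)%g) ;
  lie_inv_smooth : forall c1 c2, atlas c1 -> atlas c2 ->
    smooth_on
      [set x | (chart_fun c1 @` chart_dom c1) x /\
               chart_dom c2 ((chart_inv c1 x)^-1)%g]
      (fun x => chart_fun c2 ((chart_inv c1 x)^-1)%g) ;
  base_chart : chart G n ;
  base_chart_atlas : atlas base_chart ;
  base_chart_dom : chart_dom base_chart 1%g
}.

End Smooth.

Section LieAlgebra.
Variables (R : realType) (G : topologicalGroupType) (n : nat).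
Variable L : lie_structure R G n.

Local Notation phi := (chart_fun (base_chart L)).
Local Notation phiV := (chart_inv (base_chart L)).
Local Notation lieT := ('rV[R]_n).

Definition Ad (g : G) (X : lieT) : lieT :=
  'D_X (fun x => phi (g * phiV x * g^-1)%g) (phi 1%g).

(* The bracket [X, Y], as the differential of [Ad] at 1. *)
Definition ad (X Y : lieT) : lieT :=
  'D_X (fun x => Ad (phiV x) Y) (phi 1%g).

Definition killing (X Y : lieT) : R := \tr (lin1_mx (ad X \o ad Y)).

(* Bourbaki's definition: 0 is the only abelian ideal. *)
Definition semisimple : Prop :=
  forall V : {vspace lieT},
    (forall X Y, Y \in V -> ad X Y \in V) ->
    (forall X Y, X \in V -> Y \in V -> ad X Y = 0) ->
    V = 0%VS.

Definition one_parameter_subgroup (c : R -> G) (X : lieT) : Prop :=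
  [/\ (forall s t, c (s + t) = (c s * c t)%g), continuous c
    & is_derive (0 : R) (1 : R) (phi \o c) X].

Definition is_exp (X : lieT) (g : G) : Prop :=
  exists2 c, one_parameter_subgroup c X & c 1 = g.

Definition lie_of (H : set G) : set lieT :=
  [set X | exists2 c, one_parameter_subgroup c X & forall t, H (c t)].

Definition dualv (aa : {vspace lieT}) : Type := 'Hom(subvs_of aa, R^o).
HB.instance Definition _ aa := Vector.on (dualv aa).

Definition dual_app (aa : {vspace lieT}) (nu : dualv aa)
    (H : subvs_of aa) : R := (nu : 'Hom(subvs_of aa, R^o)) H.

Definition root_space (aa : {vspace lieT}) (alpha : dualv aa) : set lieT :=
  [set X | forall H : subvs_of aa, ad (vsval H) X = dual_app alpha H *: X].

Definition is_root (aa : {vspace lieT}) (alpha : dualv aa) : Prop :=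
  alpha <> 0 /\ exists2 X, root_space alpha X & X <> 0.

(* [theta] is the Cartan involution determined by [K], [aa] is maximal abelian
   in its (-1)-eigenspace, [chamber] is a regular element of [aa] defining the
   positive roots and [nn] is the sum of the positive root spaces.
   [iwa_log] inverts the diffeomorphism [exp : aa -> A]. *)
Record iwasawa (K : set G) := Iwasawa {
  theta : 'End(lieT) ;
  theta_ad : forall X Y, theta (ad X Y) = ad (theta X) (theta Y) ;
  theta_invol : forall X, theta (theta X) = X ;
  theta_pos : forall X, X <> 0 -> 0 < - killing X (theta X) ;
  theta_fixed : forall X, theta X = X <-> lie_of K X ;
  aa : {vspace lieT} ;
  aa_theta : forall X, X \in aa -> theta X = - X ;
  aa_abelian : forall X Y, X \in aa -> Y \in aa -> ad X Y = 0 ;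
  aa_maximal : forall X, theta X = - X ->
    (forall Y, Y \in aa -> ad X Y = 0) -> X \in aa ;
  chamber : subvs_of aa ;
  chamber_regular :
    forall alpha : dualv aa, is_root alpha -> dual_app alpha chamber <> 0 ;
  nn : {vspace lieT} ;
  nn_roots : forall alpha : dualv aa, is_root alpha ->
    0 < dual_app alpha chamber ->
    forall X, root_space alpha X -> X \in nn ;
  nn_smallest : forall V : {vspace lieT},
    (forall alpha : dualv aa, is_root alpha ->
       0 < dual_app alpha chamber ->
       forall X, root_space alpha X -> X \in V) -> (nn <= V)%VS ;
  iwa_A : set G := [set g | exists2 X, X \in aa & is_exp X g] ;
  iwa_N : set G := [set g | exists2 X, X \in nn & is_exp X g] ;
  iwa_k : G -> G ;
  iwa_a : G -> G ;
  iwa_n : G -> G ;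
  iwa_mem : forall g, [/\ K (iwa_k g), iwa_A (iwa_a g) & iwa_N (iwa_n g)] ;
  iwa_eq : forall g, g = (iwa_k g * iwa_a g * iwa_n g)%g ;
  iwa_uniq : forall k a u, K k -> iwa_A a -> iwa_N u ->
    [/\ iwa_k (k * a * u)%g = k, iwa_a (k * a * u)%g = a
      & iwa_n (k * a * u)%g = u] ;
  iwa_log : G -> subvs_of aa ;
  iwa_logP : forall (H : subvs_of aa) g, is_exp (vsval H) g -> iwa_log g = H
}.

End LieAlgebra.

Section Characters.
Variables (R : realType) (G : topologicalGroupType) (n : nat).
Variables (L : lie_structure R G n) (K : set G) (I : iwasawa L K).

Definition astar := dualv (aa I).
HB.instance Definition _ := Vector.on astar.

Definition cexp (z : R[i]) : R[i] :=
  ((expR (complex.Re z) * cos (complex.Im z))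
   +i* (expR (complex.Re z) * sin (complex.Im z)))%C.

(* [a ^ nu] for a complex-valued functional [nu] on the Lie algebra of A. *)
Definition apow (a : G) (nu : subvs_of (aa I) -> R[i]) : R[i] :=
  cexp (nu (iwa_log I a)).

Definition rho (H : subvs_of (aa I)) : R :=
  2^-1 * \sum_(j < \dim (nn I))
           coord (vbasis (nn I)) j (ad L (vsval H) (vbasis (nn I))`_j).

(* [M = Z_K(A)] *)
Definition iwa_M : set G :=
  [set m | K m /\ forall a, iwa_A I a -> (m * a = a * m)%g].

Definition normalizer_A : set G :=
  [set k | K k /\ forall a, iwa_A I a <-> iwa_A I (k * a * k^-1)%g].

(* [(k . lambda)(H) = lambda (Ad(k)^-1 H)] *)
Definition weyl_fixes (k : G) (lambda : astar) : Prop :=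
  forall H : subvs_of (aa I),
    dual_app lambda (vsproj (aa I) (Ad L (k^-1)%g (vsval H)))
    = dual_app lambda H.

Definition regular (lambda : astar) : Prop :=
  forall k, normalizer_A k -> weyl_fixes k lambda -> iwa_M k.

(* The norm dual to the Killing form metric on the Lie algebra of A. *)
Definition astar_norm (lambda : astar) : R :=
  sup [set `|dual_app lambda H| | H in
        [set H : subvs_of (aa I) | killing L (vsval H) (vsval H) <= 1]].

(* The rays of [lambda] converge to the point [l] of the unit sphere. *)
Definition ray_cvg (lambda : nat -> astar) (l : astar) : Prop :=
  astar_norm l = 1 /\
  (fun j => astar_norm ((astar_norm (lambda j))^-1 *: lambda j - l))
    @ \oo --> (0 : R).

End Characters.

Section ComplexAnalysis.
Variable R : realType.

(* The topology of [R[i]] is that of R x R. *)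
Definition cvgC (u : nat -> R[i]) (z : R[i]) : Prop :=
  (fun j => complex.Re (u j)) @ \oo --> complex.Re z /\
  (fun j => complex.Im (u j)) @ \oo --> complex.Im z.

Definition limC (u : nat -> R[i]) : R[i] :=
  ((limn (fun j => complex.Re (u j))) +i* (limn (fun j => complex.Im (u j))))%C.

Definition mx_continuous (T : topologicalType) (S : set T) m n
    (f : T -> 'M[R[i]]_(m, n)) : Prop :=
  forall i j, {within S, continuous (fun x => complex.Re (f x i j))} /\
              {within S, continuous (fun x => complex.Im (f x i j))}.

Definition cint d (X : measurableType d) (m : {measure set X -> \bar R})
    (D : set X) (f : X -> R[i]) : R[i] :=
  ((\int[m]_(x in D) complex.Re (f x)) +i* (\int[m]_(x in D) complex.Im (f x)))%C.

Definition L2 d (X : measurableType d) (m : {measure set X -> \bar R})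
    (D : set X) (f : X -> R[i]) : Prop :=
  [/\ measurable_fun D (fun x => complex.Re (f x)),
      measurable_fun D (fun x => complex.Im (f x))
    & (\int[m]_(x in D)
         ((complex.Re (f x)) ^+ 2 + (complex.Im (f x)) ^+ 2)%:E < +oo)%E].

(* The standard inner product, antilinear in the first variable.  ['cV_p] is
   V_gamma, ['cV_q] is V_kappa and ['M_(q, p)] is their tensor product, [v]
   tensor [w] being [v *m w^T]. *)
Definition mxdot m n (v w : 'M[R[i]]_(m, n)) : R[i] :=
  \sum_i \sum_j (v i j)^* * w i j.

Variable G : topologicalGroupType.

(* Maps defined on a subgroup [S] are functions on [G] of which only the values
   on [S] matter. *)
Definition unitary_rep (S : set G) d (r : G -> 'M[R[i]]_d) : Prop :=
  [/\ (forall x, S x -> r x \is unitarymx),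
      (forall x y, S x -> S y -> r (x * y)%g = r x *m r y)
    & mx_continuous S r].

Definition irreducible_unitary_rep (S : set G) d (r : G -> 'M[R[i]]_d)
    : Prop :=
  [/\ unitary_rep S r, (0 < d)%N
    & forall W : {vspace 'cV[R[i]]_d},
        (forall x v, S x -> v \in W -> r x *m v \in W) ->
        W = 0%VS \/ W = fullv].

Definition equivalent_rep (S : set G) d d' (r : G -> 'M[R[i]]_d)
    (r' : G -> 'M[R[i]]_d') : Prop :=
  exists (P : 'M[R[i]]_(d', d)) (P' : 'M[R[i]]_(d, d')),
    [/\ P *m P' = 1%:M, P' *m P = 1%:M
      & forall x, S x -> P *m r x = r' x *m P].

Definition matrix_rep := {d : nat & G -> 'M[R[i]]_d}.

(* The elements are equivalence classes of irreducible representations. *)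
Definition unitary_dual (S : set G) : set (set matrix_rep) :=
  [set c | exists d (r : G -> 'M[R[i]]_d),
     irreducible_unitary_rep S r /\
     c = [set s : matrix_rep | irreducible_unitary_rep S (projT2 s) /\
                               equivalent_rep S r (projT2 s)]].

End ComplexAnalysis.

Arguments unitary_dual R {G} S.

Section Setting.
Variables (R : realType) (G : topologicalGroupType) (n : nat).
Variables (L : lie_structure R G n) (K : set G) (I : iwasawa L K).
Variable Gamma : set G.
Local Notation X := (coset_space Gamma).
Variable mu : {measure set (borel X) -> \bar R}.
Variable haar : {measure set (borel G) -> \bar R}.

Definition invariant_measure : Prop :=
  [/\ (0 < mu setT)%E, (mu setT < +oo)%E
    & forall (g : G) (B : set (borel X)), measurable B ->
        mu [set coset_act (x : X) g | x in B] = mu B].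

(* The Haar measure of [K], as a Borel measure on [G] carried by [K]. *)
Definition haar_measure : Prop :=
  [/\ haar K = 1%E, haar (~` K) = 0%E
    & forall (k : G) (B : set (borel G)), K k -> measurable B ->
        haar [set (k * (x : G))%g | x in B] = haar B].

Variables (p : nat) (gamma : G -> 'M[R[i]]_p).
Variables (q : nat) (kappa : G -> 'M[R[i]]_q).

Definition A_gamma : set (X -> 'M[R[i]]_p) := [set f | mx_continuous setT f].

Definition A_gamma_invariant : set (X -> 'M[R[i]]_p) :=
  [set f | A_gamma f /\
     forall g k, K k ->
       gamma k *m f (coset_of_elt Gamma (g * k)%g) *m invmx (gamma k)
       = f (coset_of_elt Gamma g)].

Definition A_gamma_Kfinite : set (X -> 'M[R[i]]_p) :=
  [set f | A_gamma f /\
     exists m (b : 'I_m -> X -> 'M[R[i]]_p), forall k, K k ->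
       exists c : 'I_m -> R[i],
         forall x, f (coset_act x k) = \sum_j c j *: b j x].

Definition is_state (sigma : (X -> 'M[R[i]]_p) -> R[i]) : Prop :=
  [/\ (forall (c : R[i]) f g, A_gamma f -> A_gamma g ->
         sigma (fun x => c *: f x + g x) = c * sigma f + sigma g),
      (forall f, A_gamma f ->
         0 <= sigma (fun x => (map_mx Num.conj (f x))^T *m f x))
    & sigma (fun=> 1%:M) = 1].

Definition sigma_vect (u : X -> 'cV[R[i]]_p) (f : X -> 'M[R[i]]_p) : R[i] :=
  cint mu setT (fun x : borel X => mxdot (u x) (f x *m u x)).

Definition equivariant m (phi : G -> 'M[R[i]]_(q, m)) : Prop :=
  forall k h, K k -> iwa_M I h -> phi (k * h)%g = kappa (h^-1)%g *m phi k.

(* Representatives of the elements of [H^{kappa, i lambda}]; almost everywhere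
   equal functions are identified in [unitary_embedding]. *)
Definition principal_series : set (G -> 'cV[R[i]]_q) :=
  [set phi | equivariant phi /\
     forall j, L2 haar K (fun k : borel G => phi k j 0)].

Definition principal_action (lambda : astar I) (g : G)
    (phi : G -> 'cV[R[i]]_q) : G -> 'cV[R[i]]_q :=
  fun k => apow (iwa_a I (g^-1 * k)%g)
             (fun H => 'i * (dual_app lambda H)%:C%C - (rho H)%:C%C)
           *: phi (iwa_k I (g^-1 * k)%g).

(* Isometric G-maps into [L^2(Gamma \ G)], on representatives; being linear and
   isometric they respect almost everywhere equality. *)
Definition unitary_embedding (lambda : astar I)
    (xi : (G -> 'cV[R[i]]_q) -> X -> R[i]) : Prop :=
  [/\ (forall phi, principal_series phi ->
         L2 mu setT (fun x : borel X => xi phi x)),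
      (forall (c : R[i]) phi psi,
         principal_series phi -> principal_series psi ->
         {ae mu, forall x : borel X,
            xi (fun k => c *: phi k + psi k) x = c * xi phi x + xi psi x}),
      (forall phi psi, principal_series phi -> principal_series psi ->
         cint mu setT (fun x : borel X => (xi phi x)^* * xi psi x)
         = cint haar K (fun k : borel G => mxdot (phi k) (psi k)))
    & (forall g phi, principal_series phi ->
         {ae mu, forall x : borel X,
            xi (principal_action lambda g phi) x = xi phi (coset_act x g)})].

Definition xi_tensor (xi : (G -> 'cV[R[i]]_q) -> X -> R[i])
    (phi : G -> 'M[R[i]]_(q, p)) : X -> 'cV[R[i]]_p :=
  fun x => \col_j xi (fun k => col j (phi k)) x.

Definition sigma_xi (xi : (G -> 'cV[R[i]]_q) -> X -> R[i])
    (phi psi : G -> 'M[R[i]]_(q, p)) (f : X -> 'M[R[i]]_p) : R[i] :=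
  cint mu setT (fun x : borel X =>
    mxdot (xi_tensor xi phi x) (f x *m xi_tensor xi psi x)).

(* K-finite vectors, through their unique continuous representatives. *)
Definition CK : set (G -> 'cV[R[i]]_q) :=
  [set phi | [/\ equivariant phi, mx_continuous K phi
     & exists m (b : 'I_m -> G -> 'cV[R[i]]_q), forall k, K k ->
         exists c : 'I_m -> R[i],
           forall k', K k' -> phi (k^-1 * k')%g = \sum_j c j *: b j k']].

Definition CK_tensor : set (G -> 'M[R[i]]_(q, p)) :=
  [set phi | forall j, CK (fun k => col j (phi k))].

Definition embedding_sequence (l : astar I) (lambda : nat -> astar I)
    (xi : nat -> (G -> 'cV[R[i]]_q) -> X -> R[i]) : Prop :=
  [/\ (forall j, unitary_embedding (lambda j) (xi j)),
      (fun j => astar_norm (lambda j)) @ \oo --> +oo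
    & ray_cvg lambda l].

Definition L_kappa : set (astar I) :=
  [set l | exists lambda xi, embedding_sequence l lambda xi].

Definition conveniently_arranged (l : astar I) (lambda : nat -> astar I)
    (xi : nat -> (G -> 'cV[R[i]]_q) -> X -> R[i]) : Prop :=
  [/\ embedding_sequence l lambda xi, (forall j, regular (lambda j))
    & forall phi psi, CK_tensor phi -> CK_tensor psi ->
        forall f, A_gamma f ->
          exists z, cvgC (fun j => sigma_xi (xi j) phi psi f) z].

Definition sigma_lim (xi : nat -> (G -> 'cV[R[i]]_q) -> X -> R[i])
    (phi psi : G -> 'M[R[i]]_(q, p)) (f : X -> 'M[R[i]]_p) : R[i] :=
  limC (fun j => sigma_xi (xi j) phi psi f).

(* [(kappa (x) gamma)(m) T = T] for m in M *)
Definition M_invariant (T : 'M[R[i]]_(q, p)) : Prop :=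
  forall m, iwa_M I m -> kappa m *m T *m (gamma m)^T = T.

Definition psi_T (T : 'M[R[i]]_(q, p)) : G -> 'M[R[i]]_(q, p) :=
  fun k => T *m (gamma k)^T.

(* [v |-> F(.) v] is a K-map from the representation [r] to the sections. *)
Definition intertwiner d (r : G -> 'M[R[i]]_d) (F : G -> 'M[R[i]]_(q, d))
    : Prop :=
  [/\ equivariant F, mx_continuous K F
    & forall k k', K k -> K k' -> F (k^-1 * k')%g = F k' *m r k].

(* The isotypic subspace of the class [c].  The isotypic distribution sections
   form a finite-dimensional space of smooth functions, so there is no need for
   general distributions. *)
Definition isotypic (c : set (matrix_rep R G)) : set (G -> 'cV[R[i]]_q) :=
  [set phi | exists s, c s /\
     exists m (F : 'I_m -> G -> 'M[R[i]]_(q, projT1 s))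
            (v : 'I_m -> 'cV[R[i]]_(projT1 s)),
       (forall j, intertwiner (projT2 s) (F j)) /\
       forall k, K k -> phi k = \sum_j F j k *m v j].

Definition isotypic_tensor (c : set (matrix_rep R G))
    : set (G -> 'M[R[i]]_(q, p)) :=
  [set phi | forall j, isotypic c (fun k => col j (phi k))].

Definition is_delta (T : 'M[R[i]]_(q, p)) (c : set (matrix_rep R G))
    (delta : G -> 'M[R[i]]_(q, p)) : Prop :=
  isotypic_tensor c delta /\
  forall phi, isotypic_tensor c phi ->
    cint haar K (fun k : borel G => mxdot (delta k) (phi k))
    = mxdot T (phi 1%g).

(* A state on A_gamma extending the functional sigma_T, where [delta c] stands
   for the [c]-isotypic component of delta_T; the extension is unique since
   the K-finite elements are dense and states are continuous. *)
Definition is_sigma_T (xi : nat -> (G -> 'cV[R[i]]_q) -> X -> R[i])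
    (T : 'M[R[i]]_(q, p))
    (delta : set (matrix_rep R G) -> G -> 'M[R[i]]_(q, p))
    (sigma : (X -> 'M[R[i]]_p) -> R[i]) : Prop :=
  is_state sigma /\
  forall f, A_gamma_Kfinite f ->
    sigma f = \sum_(c \in unitary_dual R K)
                sigma_lim xi (psi_T T) (delta c) f.

End Setting.

(* Main.v *)
(* Let f be K-invariant and write B(phi, psi) for sigma^{xi_n}_{phi, psi}(f).
   Since xi_n is K-equivariant and the measure is invariant, B is invariant
   under the diagonal action of K, and psi_T is K-invariant, so that
   B(psi_T, psi) = B(psi_T, P psi), P being the average over K.  The K-invariant
   sections are the psi_S with S invariant under M, and P delta_{T,mu} = psi_S
   where S is the mu-component of T for the decomposition of the conjugate of
   gamma into irreducibles: by Schur's lemma the other components of S vanish,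
   and the mu-component is found by pairing with the psi_S'.  Hence
   B(psi_T, delta_{T,mu}) is nonzero for finitely many mu only, and its sum over
   mu is B(psi_T, psi_T), exactly and for every n.  Pass to the limit. *)

Require Import Defs.
From HB Require Import structures.
From mathcomp Require Import all_boot all_order all_algebra spectral finmap.
From mathcomp Require Import complex lra.
From mathcomp Require Import all_classical all_reals all_analysis.
From mathcomp Require Import measurable_realfun.

Set Implicit Arguments.
Unset Strict Implicit.
Unset Printing Implicit Defensive.

Import Order.TTheory GRing.Theory Num.Theory numFieldNormedType.Exports.

Local Open Scope classical_set_scope.
Local Open Scope ring_scope.
Local Open Scope sesquilinear_scope.

(** Averaging over K is carried out on matrices rather than on sections. An isotypic section is a
    sum of terms F(k) V with F an intertwiner from an irreducible r and V a constant matrix, and the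
    diagonal action of k replaces V by r(k) V gamma(k)^T. For fixed F, B(psi_T, F V) is a linear
    form in V on a finite-dimensional space, so it commutes with the integral over K, and no
    vector-valued integral has to be moved through xi_n. The mean Q of V satisfies r(k) Q gamma(k)^T
    = Q, that is, Q intertwines the conjugate of gamma with r; this is where the conjugate comes
    from. The resulting decomposition is the same for every n, because K acts on each principal
    series by left translation, whatever lambda_n is. The defining sum of sigma_T computes
    sigma_T(f) directly: f(xk) is f(x) conjugated by gamma(k), so a K-invariant f is K-finite.
    Embeddings are given on representatives, hence identities between their values hold almost
    everywhere only, and measurability is checked each time such an identity is integrated. *)

Section ComplexParts.
Variable R : realType.
Implicit Types z w : R[i].

Lemma cReD z w : complex.Re (z + w) = complex.Re z + complex.Re w.
Proof. by case: z w => a b [c d]. Qed.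

Lemma cImD z w : complex.Im (z + w) = complex.Im z + complex.Im w.
Proof. by case: z w => a b [c d]. Qed.

Lemma cReM z w :
  complex.Re (z * w) = complex.Re z * complex.Re w - complex.Im z * complex.Im w.
Proof. by case: z w => a b [c d]. Qed.

Lemma cImM z w :
  complex.Im (z * w) = complex.Re z * complex.Im w + complex.Im z * complex.Re w.
Proof. by case: z w => a b [c d]. Qed.

Lemma cReJ z : complex.Re z^* = complex.Re z.
Proof. by case: z. Qed.

Lemma cImJ z : complex.Im z^* = - complex.Im z.
Proof. by case: z. Qed.

Lemma eq_cplx z w :
  complex.Re z = complex.Re w -> complex.Im z = complex.Im w -> z = w.
Proof. by case: z w => a b [c d] /= -> ->. Qed.

End ComplexParts.

(** * Continuity of complex and matrix-valued functions *)

Section ContinuousMatrix.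
Variables (R : realType) (T : topologicalType) (S : set T).

(** Convertible with one entry of [mx_continuous], so that the two notions are exchanged without
    rewriting. *)
Definition cplx_continuous (f : T -> R[i]) : Prop :=
  {within S, continuous (fun x => complex.Re (f x))} /\
  {within S, continuous (fun x => complex.Im (f x))}.

Lemma cplx_continuousD f g : cplx_continuous f -> cplx_continuous g ->
  cplx_continuous (fun x => f x + g x).
Proof.
move=> [f1 f2] [g1 g2]; split.
  rewrite (_ : (fun x => _) = (fun x => complex.Re (f x) + complex.Re (g x))).
    by move=> x; apply: cvgD; [exact: f1|exact: g1].
  by apply/funext => x; rewrite cReD.
rewrite (_ : (fun x => _) = (fun x => complex.Im (f x) + complex.Im (g x))).
  by move=> x; apply: cvgD; [exact: f2|exact: g2].
by apply/funext => x; rewrite cImD.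
Qed.

Lemma cplx_continuousM f g : cplx_continuous f -> cplx_continuous g ->
  cplx_continuous (fun x => f x * g x).
Proof.
move=> [f1 f2] [g1 g2]; split.
  rewrite (_ : (fun x => _) =
    (fun x => complex.Re (f x) * complex.Re (g x)
              - complex.Im (f x) * complex.Im (g x))).
    move=> x; apply: cvgB; apply: cvgM;
      [exact: f1|exact: g1|exact: f2|exact: g2].
  by apply/funext => x; rewrite cReM.
rewrite (_ : (fun x => _) =
  (fun x => complex.Re (f x) * complex.Im (g x)
            + complex.Im (f x) * complex.Re (g x))).
  move=> x; apply: cvgD; apply: cvgM;
    [exact: f1|exact: g2|exact: f2|exact: g1].
by apply/funext => x; rewrite cImM.
Qed.

Lemma cplx_continuousJ f : cplx_continuous f ->
  cplx_continuous (fun x => (f x)^*).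
Proof.
move=> [f1 f2]; split; first by under eq_fun do rewrite cReJ.
rewrite (_ : (fun x => _) = (fun x => - complex.Im (f x))).
  by move=> x; apply: cvgN; exact: f2.
by apply/funext => x; rewrite cImJ.
Qed.

Lemma cplx_continuous_cst c : cplx_continuous (fun=> c).
Proof. by split=> x; exact: cvg_cst. Qed.

Lemma cplx_continuous_sum (J : finType) (f : J -> T -> R[i]) :
  (forall j, cplx_continuous (f j)) ->
  cplx_continuous (fun x => \sum_j f j x).
Proof.
move=> fc; rewrite (_ : (fun x => _) = \sum_j f j); last first.
  by apply/funext => x; rewrite fct_sumE.
elim/big_ind: _ => [|g h|j _]; [exact: cplx_continuous_cst| |exact: fc].
exact: cplx_continuousD.
Qed.

Lemma eq_cplx_continuous f g : (forall x, S x -> f x = g x) ->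
  cplx_continuous f -> cplx_continuous g.
Proof.
move=> fg [f1 f2]; split.
  apply: (@subspace_eq_continuous _ _ _ (fun x => complex.Re (f x))) f1.
  by move=> x /set_mem Sx; rewrite fg.
apply: (@subspace_eq_continuous _ _ _ (fun x => complex.Im (f x))) f2.
by move=> x /set_mem Sx; rewrite fg.
Qed.

Lemma mx_continuous_cst m n (A : 'M[R[i]]_(m, n)) : mx_continuous S (fun=> A).
Proof. by move=> i j; exact: cplx_continuous_cst. Qed.

Lemma mx_continuous_mul m n p (f : T -> 'M[R[i]]_(m, n))
    (g : T -> 'M[R[i]]_(n, p)) :
  mx_continuous S f -> mx_continuous S g ->
  mx_continuous S (fun x => f x *m g x).
Proof.
move=> fc gc i j.
suff: cplx_continuous (fun x => (f x *m g x) i j) by [].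
rewrite (_ : (fun x => _) = (fun x => \sum_k f x i k * g x k j)); last first.
  by apply/funext => x; rewrite mxE.
by apply: cplx_continuous_sum => k; apply: cplx_continuousM; [exact: fc|exact: gc].
Qed.

Lemma mx_continuous_tr m n (f : T -> 'M[R[i]]_(m, n)) :
  mx_continuous S f -> mx_continuous S (fun x => (f x)^T).
Proof.
move=> fc i j; suff: cplx_continuous (fun x => (f x)^T i j) by [].
by under eq_fun do rewrite mxE; exact: fc.
Qed.

Lemma mx_continuous_conj m n (f : T -> 'M[R[i]]_(m, n)) :
  mx_continuous S f -> mx_continuous S (fun x => map_mx Num.conj (f x)).
Proof.
move=> fc i j; suff: cplx_continuous (fun x => map_mx Num.conj (f x) i j) by [].
by under eq_fun do rewrite mxE; apply: cplx_continuousJ; exact: fc.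
Qed.

Lemma mx_continuous_mxdot m n (f g : T -> 'M[R[i]]_(m, n)) :
  mx_continuous S f -> mx_continuous S g ->
  cplx_continuous (fun x => mxdot (f x) (g x)).
Proof.
move=> cf cg; apply: cplx_continuous_sum => i; apply: cplx_continuous_sum => j.
by apply: cplx_continuousM; [apply: cplx_continuousJ; exact: cf|exact: cg].
Qed.

End ContinuousMatrix.

(** * Unitary representations *)

Section Representations.
Variable R : realType.
Local Notation C := R[i].

Lemma mxdotE m n (A B : 'M[C]_(m, n)) : mxdot A B = \tr (A^t* *m B).
Proof.
rewrite /mxdot /mxtrace exchange_big; apply: eq_bigr => j _.
by rewrite mxE; apply: eq_bigr => i _; rewrite !mxE.
Qed.

Lemma mxdot_eq0 m n (A : 'M[C]_(m, n)) : mxdot A A = 0 -> A = 0.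
Proof.
move=> /eqP; rewrite /mxdot psumr_eq0; last first.
  by move=> i _; apply: sumr_ge0 => j _; rewrite mulrC mul_conjC_ge0.
move=> /allP Ai; apply/matrixP => i j; rewrite mxE.
have := Ai i (mem_index_enum _); rewrite /= psumr_eq0; last first.
  by move=> k _; rewrite mulrC mul_conjC_ge0.
by move=> /allP/(_ j (mem_index_enum _)) /=; rewrite mulrC mul_conjC_eq0 => /eqP.
Qed.

Lemma mxdotBl m n (A B D : 'M[C]_(m, n)) :
  mxdot (A - B) D = mxdot A D - mxdot B D.
Proof. by rewrite !mxdotE raddfB /= map_mxB mulmxBl raddfB. Qed.

(** The columns of [U] are an orthonormal basis of [W], found by Gram-Schmidt. As [schmidt] works on
    rows, [W] is first transposed into the row space of a matrix [A]; the projection [projv], not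
    orthogonal in general, serves only to produce [A]. *)
Lemma vspace_isometry p (W : {vspace 'cV[C]_p}) :
  exists d (U : 'M[C]_(p, d)), U^t* *m U = 1%:M /\
    forall v, v \in W <-> U *m U^t* *m v = v.
Proof.
pose f (u : 'rV[C]_p) := (projv W u^T)^T.
have flin : linear f by move=> a u v; rewrite /f !linearP.
pose fL : {linear 'rV[C]_p -> 'rV[C]_p} :=
  HB.pack f (GRing.isLinear.Build _ _ _ _ f flin).
pose A := lin1_mx fL.
have AE u : u *m A = (projv W u^T)^T by rewrite mul_rV_lin1.
have WA v : v \in W <-> (v^T <= A)%MS.
  split=> [vW|/submxP[u uA]].
    by apply/submxP; exists v^T; rewrite AE trmxK projv_id.
  by rewrite -[v]trmxK uA AE trmxK memv_proj.
have le : (\rank A <= p)%N := rank_leq_col A.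
pose B := schmidt (row_base A).
have BB : B *m B^t* = 1%:M by apply/unitarymxP/schmidt_unitarymx.
have eqBA : (B :=: A)%MS.
  by apply: (eqmx_trans (eqmx_schmidt_free _)) (eq_row_base A);
     exact: row_base_free.
exists (\rank A), B^T; split.
  have -> : B^T^t* *m B^T = (B *m B^t*)^T.
    by rewrite trmx_mul map_trmx.
  by rewrite BB trmx1.
have BE v : B^T *m B^T^t* *m v = v <-> v^T *m (B^t* *m B) = v^T.
  have -> : v^T *m (B^t* *m B) = (B^T *m B^T^t* *m v)^T.
    by rewrite !trmx_mul map_trmx trmxK mulmxA.
  by split=> [->|/trmx_inj].
move=> v; rewrite WA -eqBA; apply: (iff_trans _ (iff_sym (BE _ v))); split.
  by move=> /submxP[u ->]; rewrite !mulmxA -(mulmxA u) BB mulmx1.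
by move=> <-; rewrite mulmxA submxMl.
Qed.

(** Kernel and image of [A] are invariant; as [A] is nonzero, irreducibility leaves only kernel 0
    and full image. The dimensions are not known to agree, so a right inverse is built first and
    then shown to be a left inverse. *)
Lemma schur (G : topologicalGroupType) (S : set G) d d' (r : G -> 'M[C]_d)
    (r' : G -> 'M[C]_d') (A : 'M[C]_(d', d)) :
  irreducible_unitary_rep S r -> irreducible_unitary_rep S r' ->
  (forall x, S x -> A *m r x = r' x *m A) -> A <> 0 -> equivalent_rep S r r'.
Proof.
move=> [_ _ irr] [_ _ irr'] Ar A0.
pose f := linfun (mulmx A : 'cV[C]_d -> 'cV[C]_d').
have fE v : f v = A *m v by rewrite lfunE.
have kerS x v : S x -> v \in lker f -> r x *m v \in lker f.
  move=> Sx; rewrite !memv_ker !fE => /eqP Av.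
  by rewrite mulmxA Ar// -mulmxA Av mulmx0.
have imS x w : S x -> w \in limg f -> r' x *m w \in limg f.
  move=> Sx /memv_imgP[v _ ->]; rewrite fE mulmxA -Ar// -mulmxA -fE.
  by rewrite memv_img ?memvf.
have [ker|ker] := irr _ kerS; last first.
  case: A0; apply/matrixP => i j.
  have : delta_mx j 0 \in lker f by rewrite ker memvf.
  by rewrite memv_ker fE -colE => /eqP/colP/(_ i); rewrite !mxE.
have [im|im] := irr' _ imS.
  case: A0; apply/matrixP => i j.
  have : f (delta_mx j 0) \in limg f by rewrite memv_img ?memvf.
  by rewrite im memv0 fE -colE => /eqP/colP/(_ i); rewrite !mxE.
have [P' AP'] : exists P', A *m P' = 1%:M.
  have /choice[g gP] : forall j : 'I_d', exists v, A *m v = delta_mx j (0 : 'I_1).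
    move=> j; have /memv_imgP[v _ ->] : delta_mx j 0 \in limg f.
      by rewrite im memvf.
    by exists v; rewrite fE.
  exists (\matrix_(i, j) g j i 0); apply/matrixP => i j.
  have /colP/(_ i) := gP j; rewrite !mxE eqxx andbT => <-.
  by apply: eq_bigr => k _; rewrite !mxE.
exists A, P'; split=> //; apply/matrixP => i j.
(* A (P' A - 1) = 0 and the kernel of A is trivial. *)
have : col j (P' *m A - 1%:M) \in lker f.
  rewrite memv_ker fE !colE mulmxA mulmxBr mulmxA AP' mul1mx mulmx1 subrr.
  by rewrite mul0mx.
rewrite ker memv0 => /eqP/colP/(_ i); rewrite !mxE => /eqP.
by rewrite subr_eq0 => /eqP.
Qed.

Lemma col_mulmx m n p (A : 'M[C]_(m, n)) (B : 'M[C]_(n, p)) j :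
  col j (A *m B) = A *m col j B.
Proof. by rewrite !colE mulmxA. Qed.

Lemma adjM m n p (A : 'M[C]_(m, n)) (B : 'M[C]_(n, p)) :
  (A *m B)^t* = B^t* *m A^t*.
Proof. by rewrite trmx_mul map_mxM. Qed.

Lemma adjK m n (A : 'M[C]_(m, n)) : A^t*^t* = A.
Proof. exact: trmxCK. Qed.

Section Unitary.
Variables (G : topologicalGroupType) (S : set G).

Lemma unitary_rep_restrict p d (r : G -> 'M[C]_p) (U : 'M[C]_(p, d)) :
  unitary_rep S r -> U^t* *m U = 1%:M ->
  (forall x, S x -> r x *m U = U *m (U^t* *m r x *m U)) ->
  unitary_rep S (fun x => U^t* *m r x *m U).
Proof.
move=> [ru rM rc] UU rU; split.
- move=> x Sx; apply/unitarymxP; apply: mulmx1C.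
  have r1 : (r x)^t* *m r x = 1%:M by apply: mulmx1C; exact/unitarymxP/ru.
  have -> : (U^t* *m r x *m U)^t* = U^t* *m (r x)^t* *m U.
    by rewrite !adjM adjK mulmxA.
  by rewrite -(mulmxA _ U) -rU// mulmxA -(mulmxA (U^t* )) r1 mulmx1.
- move=> x y Sx Sy; rewrite rM// mulmxA -(mulmxA _ (r y)) (rU y)//.
  by rewrite !mulmxA.
- apply: mx_continuous_mul; last exact: mx_continuous_cst.
  by apply: mx_continuous_mul => //; exact: mx_continuous_cst.
Qed.

(** Complete reducibility by strong induction on the dimension: an invariant subspace and its
    orthogonal complement are both stable and strictly smaller. The outcome is recorded as
    intertwiners [U j] with a resolution of the identity. *)
Lemma unitary_rep_decomposition p (r : G -> 'M[C]_p) : unitary_rep S r ->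
  exists (J : finType) (s : J -> matrix_rep R G)
         (U : forall j, 'M[C]_(p, projT1 (s j))),
    [/\ forall j, irreducible_unitary_rep S (projT2 (s j)),
        forall j x, S x -> r x *m U j = U j *m projT2 (s j) x
      & \sum_j U j *m (U j)^t* = 1%:M].
Proof.
have [N] := ubnP p; elim: N => // N IH in p r * => /ltnSE pN ru.
have [p0|p_gt0] := posnP p.
  (* In dimension 0, where no representation counts as irreducible, the family is empty. *)
  exists void, (of_void _), (fun v : void => match v with end).
  by split=> [[]|[]|]; apply/matrixP => i; have := ltn_ord i;
    rewrite [X in (_ < X)%N]p0.
pose inv (W : {vspace 'cV[C]_p}) :=
  forall x v, S x -> v \in W -> r x *m v \in W.
have [irr|] := pselect (forall W, inv W -> W = 0%VS \/ W = fullv).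
  exists unit, (fun=> existT _ p r), (fun=> 1%:M); split=> //=.
    by move=> _ x Sx; rewrite mulmx1 mul1mx.
  by rewrite (big_pred1 tt) ?trmx1 ?map_mx1 ?mulmx1// => -[].
move=> /existsNP[W /not_implyP[Winv /not_orP[W0 Wfull]]].
have [d1 [U1 [UU1 U1P]]] := vspace_isometry W.
(* The kernel of the adjoint of [U1] is the orthogonal complement of [W]. *)
pose f := linfun (mulmx (U1^t* ) : 'cV[C]_p -> 'cV[C]_d1).
have fE v : f v = U1^t* *m v by rewrite lfunE.
have [d2 [U2 [UU2 U2P]]] := vspace_isometry (lker f).
have kerP v : v \in lker f <-> U1^t* *m v = 0.
  by rewrite memv_ker fE; split=> /eqP.
have colsP d m (U : 'M[C]_(p, d)) (A : 'M[C]_(p, m)) :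
    (forall j, U *m U^t* *m col j A = col j A) -> U *m U^t* *m A = A.
  move=> UA; apply/matrixP => i j.
  by have /colP/(_ i) := UA j; rewrite -col_mulmx !mxE.
have U12 : U1^t* *m U2 = 0.
  apply/matrixP => i j.
  have : U1^t* *m col j U2 = 0.
    by apply/kerP/U2P; rewrite -col_mulmx -mulmxA UU2 mulmx1.
  by rewrite -col_mulmx => /colP/(_ i); rewrite !mxE.
have U21 : U2^t* *m U1 = 0.
  by rewrite -[LHS]adjK adjM adjK U12 trmx0 map_mx0.
have rU1 x : S x -> r x *m U1 = U1 *m (U1^t* *m r x *m U1).
  move=> Sx; rewrite !mulmxA -(mulmxA _ (r x)); apply/esym/colsP => j.
  apply/U1P; rewrite col_mulmx; apply: Winv => //; apply/U1P.
  by rewrite -col_mulmx -mulmxA UU1 mulmx1.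
have ru1 := unitary_rep_restrict ru UU1 rU1.
have rU2 x : S x -> r x *m U2 = U2 *m (U2^t* *m r x *m U2).
  move=> Sx; rewrite !mulmxA -(mulmxA _ (r x)); apply/esym/colsP => j.
  apply/U2P/kerP; rewrite col_mulmx.
  have [uni _ _] := ru; have [uni1 _ _] := ru1.
  (* The adjoint of the intertwining relation for [U1], using that r is unitary; it makes the
     orthogonal complement stable. *)
  have adjrU : U1^t* *m r x = (U1^t* *m r x *m U1) *m U1^t*.
    set r1 := U1^t* *m r x *m U1.
    have r1K : r1 *m r1^t* = 1%:M by apply/unitarymxP/uni1.
    have rK : (r x)^t* *m r x = 1%:M by apply: mulmx1C; exact/unitarymxP/uni.
    have /(congr1 (fun A => A^t* *m r x)) : r x *m U1 = U1 *m r1 by exact: rU1.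
    rewrite (adjM (r x)) (adjM U1) -mulmxA rK mulmx1 => E.
    by rewrite [in RHS]E !mulmxA r1K mul1mx.
  have UU0 : U1^t* *m col j U2 = 0.
    by rewrite -col_mulmx U12; apply/colP => i; rewrite !mxE.
  by rewrite mulmxA adjrU -(mulmxA _ _ (col j U2)) UU0 mulmx0.
have ru2 := unitary_rep_restrict ru UU2 rU2.
have UUsum : U1 *m U1^t* + U2 *m U2^t* = 1%:M.
  have : U2 *m U2^t* *m (1%:M - U1 *m U1^t*) = 1%:M - U1 *m U1^t*.
    apply: colsP => j; apply/U2P/kerP; rewrite -col_mulmx mulmxBr mulmxA UU1.
    by rewrite mul1mx mulmx1 subrr; apply/colP => i; rewrite !mxE.
  rewrite mulmxBr mulmx1 mulmxA -(mulmxA U2) U21 mulmx0 mul0mx subr0 => ->.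
  by rewrite addrC subrK.
(* An isometry has d <= p by rank, and for d = p it is square, hence unitary, against the second
   premise. *)
have lt d (U : 'M[C]_(p, d)) : U^t* *m U = 1%:M -> U *m U^t* <> 1%:M ->
    (d < p)%N.
  move=> UU UU'; rewrite ltnNge; apply/negP => pd.
  have dp : (d <= p)%N.
    by rewrite -(mxrank1 C d) -UU (leq_trans (mxrankM_maxr _ _)) ?rank_leq_row.
  have ed : d = p by apply/eqP; rewrite eqn_leq dp.
  by subst d; apply: UU'; exact: mulmx1C.
have d1p : (d1 < p)%N.
  apply: (lt _ U1) => // UU1'; apply: Wfull; apply/eqP; rewrite eqEsubv subvf.
  by apply/subvP => v _; apply/U1P; rewrite UU1' mul1mx.
have d2p : (d2 < p)%N.
  apply: (lt _ U2) => // UU2'; apply: W0; apply/eqP; rewrite -subv0.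
  apply/subvP => v /U1P; move: UUsum; rewrite UU2' => /(canRL (addrK _)).
  by rewrite subrr => ->; rewrite mul0mx => <-; rewrite mem0v.
have [J1 [s1 [V1 [irr1 rV1 sum1]]]] := IH _ _ (leq_trans d1p pN) ru1.
have [J2 [s2 [V2 [irr2 rV2 sum2]]]] := IH _ _ (leq_trans d2p pN) ru2.
pose s j := match j with inl a => s1 a | inr b => s2 b end.
pose V j : 'M[C]_(p, projT1 (s j)) :=
  match j with inl a => U1 *m V1 a | inr b => U2 *m V2 b end.
exists (J1 + J2)%type, s, V; split.
- by case.
- case=> [a|b] x Sx /=; rewrite mulmxA.
  + by rewrite rU1// -mulmxA rV1// mulmxA.
  + by rewrite rU2// -mulmxA rV2// mulmxA.
- rewrite big_sumType /= -UUsum; congr (_ + _).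
  + rewrite -[X in _ = X *m _]mulmx1 -sum1 mulmx_sumr mulmx_suml.
    by apply: eq_bigr => j _; rewrite adjM !mulmxA.
  + rewrite -[X in _ = X *m _]mulmx1 -sum2 mulmx_sumr mulmx_suml.
    by apply: eq_bigr => j _; rewrite adjM !mulmxA.
Qed.

Lemma equivalent_rep_refl d (r : G -> 'M[C]_d) : equivalent_rep S r r.
Proof.
by exists 1%:M, 1%:M; split=> [||x _]; rewrite ?mulmx1 ?mul1mx.
Qed.

Lemma equivalent_rep_sym d d' (r : G -> 'M[C]_d) (r' : G -> 'M[C]_d') :
  equivalent_rep S r r' -> equivalent_rep S r' r.
Proof.
move=> [P [P' [PP' P'P rP]]]; exists P', P; split=> // x Sx.
by rewrite -[LHS]mulmx1 -PP' -mulmxA (mulmxA _ P) -rP// !mulmxA P'P mul1mx.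
Qed.

Lemma equivalent_rep_trans d d' d'' (r : G -> 'M[C]_d) (r' : G -> 'M[C]_d')
    (r'' : G -> 'M[C]_d'') :
  equivalent_rep S r r' -> equivalent_rep S r' r'' -> equivalent_rep S r r''.
Proof.
move=> [P [P' [PP' P'P rP]]] [Q [Q' [QQ' Q'Q rQ]]].
exists (Q *m P), (P' *m Q'); split=> [||x Sx].
- by rewrite mulmxA -(mulmxA Q) PP' mulmx1.
- by rewrite mulmxA -(mulmxA P') Q'Q mulmx1.
- by rewrite -mulmxA rP// mulmxA rQ// mulmxA.
Qed.

Definition rep_class (s : matrix_rep R G) : set (matrix_rep R G) :=
  [set s' | irreducible_unitary_rep S (projT2 s') /\
            equivalent_rep S (projT2 s) (projT2 s')].

Lemma rep_class_refl s : irreducible_unitary_rep S (projT2 s) -> rep_class s s.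
Proof. by move=> irr; split=> //; exact: equivalent_rep_refl. Qed.

Lemma rep_class_dual s :
  irreducible_unitary_rep S (projT2 s) -> unitary_dual R S (rep_class s).
Proof. by case: s => d r irr; exists d, r. Qed.

Lemma rep_class_eq s t :
  equivalent_rep S (projT2 s) (projT2 t) -> rep_class s = rep_class t.
Proof.
move=> st; apply/seteqP; split=> u [irr e]; split=> //.
  exact: equivalent_rep_trans (equivalent_rep_sym st) e.
exact: equivalent_rep_trans st e.
Qed.

Lemma unitary_dualP c : unitary_dual R S c ->
  exists2 s : matrix_rep R G, irreducible_unitary_rep S (projT2 s)
                              & c = rep_class s.
Proof. by move=> [d [r [irr ->]]]; exists (existT _ d r). Qed.

End Unitary.
End Representations.

(** [unitary_rep] does not ask for r(1) = 1; it follows because r(1) is invertible and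
    idempotent. *)
Lemma unitary_rep1 (R : realType) (G : topologicalGroupType) (S : set G) d
    (r : G -> 'M[R[i]]_d) : is_subgroup S -> unitary_rep S r -> r 1%g = 1%:M.
Proof.
move=> [S1 _ _] [ru rM _].
have r1u : r 1%g \in unitmx by apply: unitarymx_unit; exact: ru.
by rewrite -[LHS](mulmxK r1u) -rM// mulg1 mulmxV.
Qed.

Lemma unitary_repV (R : realType) (G : topologicalGroupType) (S : set G) d
    (r : G -> 'M[R[i]]_d) x : is_subgroup S -> unitary_rep S r -> S x ->
  r x *m r (x^-1)%g = 1%:M /\ r (x^-1)%g *m r x = 1%:M.
Proof.
move=> sS ru Sx; have [_ rM _] := ru; have [_ _ SV] := sS.
by rewrite -!rM ?mulgV ?mulVg ?(unitary_rep1 sS ru)//; exact: SV.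
Qed.

(** * Rules for the inner product on matrices *)

Section MxDot.
Variable R : realType.
Local Notation C := R[i].

Lemma mxdotDr m n (A B B' : 'M[C]_(m, n)) :
  mxdot A (B + B') = mxdot A B + mxdot A B'.
Proof. by rewrite !mxdotE mulmxDr mxtraceD. Qed.

Lemma mxdotZr m n c (A B : 'M[C]_(m, n)) : mxdot A (c *: B) = c * mxdot A B.
Proof. by rewrite !mxdotE -scalemxAr mxtraceZ. Qed.

Lemma mxdotMl m n p (U : 'M[C]_(p, m)) (A : 'M[C]_(m, n)) (B : 'M[C]_(p, n)) :
  mxdot (U *m A) B = mxdot A (U^t* *m B).
Proof. by rewrite !mxdotE adjM mulmxA. Qed.

Lemma mxdotMr m n p (A : 'M[C]_(m, n)) (B : 'M[C]_(m, p)) (U : 'M[C]_(p, n)) :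
  mxdot A (B *m U) = mxdot (A *m U^t*) B.
Proof. by rewrite !mxdotE adjM adjK mulmxA mxtrace_mulC mulmxA. Qed.

Lemma mxdotMM m n (A B : 'M[C]_(m, n)) (U : 'M[C]_n) : U *m U^t* = 1%:M ->
  mxdot (A *m U) (B *m U) = mxdot A B.
Proof. by move=> UU; rewrite mxdotMr -mulmxA UU mulmx1. Qed.

Lemma mxdotJ m n (A B : 'M[C]_(m, n)) : mxdot B A = (mxdot A B)^*.
Proof.
rewrite /mxdot rmorph_sum; apply: eq_bigr => i _; rewrite rmorph_sum.
by apply: eq_bigr => j _; rewrite rmorphM /= conjCK mulrC.
Qed.

(** Separates the entries of [A], bounded in the application, from products of two square-integrable
    functions. *)
Lemma mxdot_mulE m n (u : 'cV[C]_m) (A : 'M[C]_(m, n)) (w : 'cV[C]_n) :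
  mxdot u (A *m w) = \sum_i \sum_j A i j * ((u i 0)^* * w j 0).
Proof.
apply: eq_bigr => i _; rewrite big_ord1 mxE big_distrr; apply: eq_bigr => j _.
by rewrite /= mulrCA.
Qed.

End MxDot.

(** * Complex integrals *)

Section ComplexIntegral.
Variables (R : realType) (d : measure_display) (X : measurableType d).
Variables (m : {measure set X -> \bar R}) (D : set X).
Hypothesis mD : measurable D.
Local Notation C := R[i].
Implicit Types f g : X -> C.

Definition cplx_measurable f : Prop :=
  measurable_fun D (fun x => complex.Re (f x)) /\
  measurable_fun D (fun x => complex.Im (f x)).

Definition cplx_integrable f : Prop :=
  m.-integrable D (EFin \o (fun x => complex.Re (f x))) /\
  m.-integrable D (EFin \o (fun x => complex.Im (f x))).

Lemma cplx_measurableM f g : cplx_measurable f -> cplx_measurable g ->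
  cplx_measurable (fun x => f x * g x).
Proof.
move=> [f1 f2] [g1 g2]; split.
  under eq_fun do rewrite cReM.
  by apply: measurable_funB; exact: measurable_funM.
under eq_fun do rewrite cImM.
by apply: measurable_funD; exact: measurable_funM.
Qed.

Lemma cplx_measurableJ f : cplx_measurable f ->
  cplx_measurable (fun x => (f x)^*).
Proof.
move=> [f1 f2]; split; first by under eq_fun do rewrite cReJ.
by under eq_fun do rewrite cImJ; exact: measurableT_comp.
Qed.

Lemma cplx_integrable_measurable f : cplx_integrable f -> cplx_measurable f.
Proof.
by move=> [/measurable_int/measurable_EFinP f1 /measurable_int/measurable_EFinP f2].
Qed.

Lemma integrableZ_EFin (k : R) (h : X -> R) : m.-integrable D (EFin \o h) ->
  m.-integrable D (EFin \o (fun x => k * h x)).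
Proof. by move=> /(integrableZl mD k). Qed.

Lemma cplx_integrableD f g : cplx_integrable f -> cplx_integrable g ->
  cplx_integrable (fun x => f x + g x).
Proof.
move=> [f1 f2] [g1 g2]; split.
  by under eq_fun do rewrite cReD; exact: (integrableD mD f1 g1).
by under eq_fun do rewrite cImD; exact: (integrableD mD f2 g2).
Qed.

Lemma cplx_integrableZ c f : cplx_integrable f ->
  cplx_integrable (fun x => c * f x).
Proof.
move=> [f1 f2]; split.
  under eq_fun do rewrite cReM.
  by apply: (@integrableB _ _ _ _ _ _ (EFin \o _) (EFin \o _)) => //;
     exact: integrableZ_EFin.
under eq_fun do rewrite cImM.
by apply: (@integrableD _ _ _ _ _ _ (EFin \o _) (EFin \o _)) => //;
   exact: integrableZ_EFin.
Qed.

Lemma cplx_integrable0 : cplx_integrable (fun=> 0).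
Proof. by split; exact: integrable0. Qed.

Lemma cplx_integrable_sum (J : finType) (f : J -> X -> C) :
  (forall j, cplx_integrable (f j)) ->
  cplx_integrable (fun x => \sum_j f j x).
Proof.
move=> fc; rewrite (_ : (fun x => _) = \sum_j f j); last first.
  by apply/funext => x; rewrite fct_sumE.
elim/big_ind: _ => [|g h|j _]; [exact: cplx_integrable0| |exact: fc].
exact: cplx_integrableD.
Qed.

Lemma cintD f g : cplx_integrable f -> cplx_integrable g ->
  cint m D (fun x => f x + g x) = cint m D f + cint m D g.
Proof.
move=> [f1 f2] [g1 g2]; rewrite /cint; apply: eq_cplx => /=.
  by under [LHS]eq_Rintegral do rewrite cReD; exact: RintegralD.
by under [LHS]eq_Rintegral do rewrite cImD; exact: RintegralD.
Qed.

Lemma cintZ c f : cplx_integrable f ->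
  cint m D (fun x => c * f x) = c * cint m D f.
Proof.
move=> [f1 f2]; rewrite /cint; apply: eq_cplx => /=.
  under [LHS]eq_Rintegral do rewrite cReM.
  by rewrite RintegralB ?RintegralZl ?cReM//; exact: integrableZ_EFin.
under [LHS]eq_Rintegral do rewrite cImM.
by rewrite RintegralD ?RintegralZl ?cImM//; exact: integrableZ_EFin.
Qed.

Lemma cintJ f : cplx_integrable f ->
  cint m D (fun x => (f x)^*) = (cint m D f)^*.
Proof.
move=> [f1 f2]; apply: eq_cplx; rewrite ?cReJ ?cImJ /=.
  by apply: eq_Rintegral => x _; rewrite cReJ.
rewrite -mulN1r -RintegralZl//; apply: eq_Rintegral => x _.
by rewrite cImJ mulN1r.
Qed.

Lemma cint0 : cint m D (fun=> 0) = 0.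
Proof. by apply: eq_cplx; rewrite /= /Rintegral integral0. Qed.

Lemma cint_sum (J : finType) (f : J -> X -> C) :
  (forall j, cplx_integrable (f j)) ->
  cint m D (fun x => \sum_j f j x) = \sum_j cint m D (f j).
Proof.
move=> fc; rewrite -(@fct_sumE _ _ _ _ _ (fun j => f j)).
suff [] : cplx_integrable (\sum_j f j) /\
  cint m D (\sum_j f j) = \sum_j cint m D (f j) by [].
elim/big_ind2: _ => [|g z h w [ig <-] [ih <-]|j _].
- by split; [exact: cplx_integrable0|exact: cint0].
- by split; [exact: cplx_integrableD|rewrite -cintD].
- by split.
Qed.

Lemma eq_cint f g : (forall x, D x -> f x = g x) -> cint m D f = cint m D g.
Proof.
by move=> fg; apply: eq_cplx => /=; apply: eq_Rintegral => x /set_mem Dx;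
  rewrite fg.
Qed.

(** The passage from the almost everywhere identities satisfied by embeddings to equalities of
    functionals. *)
Lemma ae_eq_cint f g : cplx_measurable f -> cplx_measurable g ->
  {ae m, forall x, f x = g x} -> cint m D f = cint m D g.
Proof.
move=> [f1 f2] [g1 g2] fg; apply: eq_cplx; rewrite /= /Rintegral; congr fine;
  apply: ae_eq_integral => //; try exact/measurable_EFinP;
  by apply: filterS fg => x -> _.
Qed.

End ComplexIntegral.

(** * Integrals under measure-preserving maps *)

Section MeasurePreserving.
Variables (R : realType) (d : measure_display) (X : measurableType d).
Variables (m : {measure set X -> \bar R}) (D : set X) (t : X -> X).
Hypotheses (mD : measurable D) (mt : measurable_fun setT t).
Hypothesis tm : forall B, measurable B -> m (t @^-1` B) = m B.
Hypothesis tD : t @^-1` D = D.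

(** The push-forward of [m] under [t] is [m]. Positive and negative parts are treated as
    non-negative functions, so measurability of [f] suffices. *)
Lemma integral_measure_preserving (f : X -> R) : measurable_fun D f ->
  \int[m]_(x in D) f (t x) = \int[m]_(x in D) f x.
Proof.
move=> mf; rewrite /Rintegral; congr fine.
rewrite integralE [RHS]integralE.
have ge0 (g : X -> \bar R) : measurable_fun D g -> (forall x, 0 <= g x)%E ->
    (\int[m]_(x in D) g (t x) = \int[m]_(x in D) g x)%E.
  move=> mg g0; rewrite -[in LHS]tD -(@ge0_integral_pushforward _ _ _ _ _ _ mt)//.
  by apply: eq_measure_integral => A mA _ /=; exact: tm.
have mF : measurable_fun D (EFin \o f) by exact/measurable_EFinP.
congr (_ - _)%E.
  transitivity (\int[m]_(x in D) ((EFin \o f)^\+)%E (t x))%E.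
    by apply: eq_integral => x _; rewrite !funeposE.
  by apply: ge0 => //; exact: measurable_funepos.
transitivity (\int[m]_(x in D) ((EFin \o f)^\-)%E (t x))%E.
  by apply: eq_integral => x _; rewrite !funenegE.
by apply: ge0 => //; exact: measurable_funeneg.
Qed.

Lemma cint_measure_preserving (f : X -> R[i]) : cplx_measurable D f ->
  cint m D (fun x => f (t x)) = cint m D f.
Proof.
move=> [f1 f2]; apply: eq_cplx => /=.
  by rewrite (integral_measure_preserving f1).
by rewrite (integral_measure_preserving f2).
Qed.

End MeasurePreserving.

(** * Products of square-integrable functions *)

Section SquareIntegrable.
Variables (R : realType) (d : measure_display) (X : measurableType d).
Variables (m : {measure set X -> \bar R}) (D : set X).
Hypothesis mD : measurable D.
Local Notation C := R[i].
Implicit Types f g u w : X -> C.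

Definition cplx_bounded f : Prop :=
  [bounded complex.Re (f x) | x in D] /\ [bounded complex.Im (f x) | x in D].

Lemma integrableM_bounded (h k : X -> R) : measurable_fun D h ->
  [bounded h x | x in D] -> m.-integrable D (EFin \o k) ->
  m.-integrable D (EFin \o (fun x => h x * k x)).
Proof. by move=> mh bh ik; exact: (integrableMr mD mh bh ik). Qed.

Lemma cplx_integrable_bounded f g : cplx_measurable D f -> cplx_bounded f ->
  cplx_integrable m D g -> cplx_integrable m D (fun x => f x * g x).
Proof.
move=> [f1 f2] [bf1 bf2] [g1 g2]; split.
  under eq_fun do rewrite cReM.
  by apply: (@integrableB _ _ _ _ _ _ (EFin \o _) (EFin \o _)) => //;
     exact: integrableM_bounded.
under eq_fun do rewrite cImM.
by apply: (@integrableD _ _ _ _ _ _ (EFin \o _) (EFin \o _)) => //;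
   exact: integrableM_bounded.
Qed.

Lemma L2_measurable u : L2 m D u -> cplx_measurable D u.
Proof. by case. Qed.

Lemma L2_integrable_sqr u : L2 m D u ->
  m.-integrable D (EFin \o (fun x => complex.Re (u x) ^+ 2 + complex.Im (u x) ^+ 2)).
Proof.
move=> [u1 u2 fin]; apply/integrableP; split.
  apply/measurable_EFinP; apply: measurable_funD; exact: measurable_funX.
apply: le_lt_trans fin; rewrite le_eqVlt; apply/orP; left; apply/eqP.
by apply: eq_integral => x _; rewrite /= ger0_norm// addr_ge0 ?sqr_ge0.
Qed.

(** A crude pointwise Cauchy-Schwarz inequality, from the squares of a + c, a - c, b + e and b - e;
    it dominates a product by the sum of the two integrable squares. *)
Lemma norm_dot2_le (a b c e : R) :
  `|a * c + b * e| <= a ^+ 2 + b ^+ 2 + (c ^+ 2 + e ^+ 2).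
Proof.
have := sqr_ge0 (a + c); have := sqr_ge0 (a - c).
have := sqr_ge0 (b + e); have := sqr_ge0 (b - e).
have := (sqr_ge0 a, sqr_ge0 b, sqr_ge0 c, sqr_ge0 e) => -[[[]]].
rewrite !sqrrB !sqrrD !mulr2n => a0 b0 c0 e0 be1 be2 ac1 ac2.
by rewrite ler_norml; apply/andP; split; lra.
Qed.

Lemma L2_integrable_mul u w : L2 m D u -> L2 m D w ->
  cplx_integrable m D (fun x => (u x)^* * w x).
Proof.
move=> Lu Lw.
have mu := L2_measurable Lu; have mw := L2_measurable Lw.
have [m1 m2] := cplx_measurableM (cplx_measurableJ mu) mw.
have intS := integrableD mD (L2_integrable_sqr Lu) (L2_integrable_sqr Lw).
split; apply: (le_integrable mD) intS => [|x _];
  try exact/measurable_EFinP.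
all: rewrite /= lee_fin [leRHS]ger0_norm ?addr_ge0 ?sqr_ge0//.
- by rewrite cReM cReJ cImJ mulNr opprK; exact: norm_dot2_le.
(* The imaginary part has the same shape with c = Im w and e = - Re w. *)
- rewrite cImM cReJ cImJ [X in _ <= _ + X]addrC mulNr -mulrN.
  rewrite -(sqrrN (complex.Re (w x))).
  exact: norm_dot2_le.
Qed.

End SquareIntegrable.

Lemma L2_ae0 (R : realType) (d : measure_display) (X : measurableType d)
    (m : {measure set X -> \bar R}) (u : X -> R[i]) : L2 m setT u ->
  cint m setT (fun x => (u x)^* * u x) = 0 -> {ae m, forall x, u x = 0}.
Proof.
move=> Lu u0; have iu := L2_integrable_sqr Lu.
set s := (fun x => complex.Re (u x) ^+ 2 + complex.Im (u x) ^+ 2) in iu *.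
have s_ge0 x : 0 <= s x by rewrite addr_ge0 ?sqr_ge0.
have us x : complex.Re ((u x)^* * u x) = s x.
  by rewrite cReM cReJ cImJ mulNr opprK -!expr2.
have : \int[m]_(x in setT) s x = 0.
  by have := congr1 (@complex.Re R) u0;
    rewrite /=; under eq_Rintegral do rewrite us.
rewrite /Rintegral => s0.
have : (\int[m]_(x in setT) `|(EFin \o s) x| = 0)%E.
  under eq_integral do rewrite /= ger0_norm//.
  by rewrite -[LHS]fineK ?s0//; exact: (integrable_fin_num measurableT iu).
have [/measurable_EFinP ms _] := integrableP _ _ _ iu.
move=> /(ae_eq_integral_abs m measurableT (iffRL (measurable_EFinP _ _) ms)).
apply: filterS => x /(_ Logic.I) [] /eqP.
rewrite /s paddr_eq0 ?sqr_ge0// !sqrf_eq0 => /andP[/eqP ur /eqP ui].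
by apply: eq_cplx.
Qed.

(** * Continuous functions on a compact set are measurable, bounded and integrable *)

Section Borel.
Variables (R : realType) (T : ptopologicalType).

Lemma borel_measurable_open (U : set T) : open U -> measurable (U : set (borel T)).
Proof. by move=> oU; exact: sub_sigma_algebra. Qed.

Lemma borel_measurable_closed (F : set T) :
  closed F -> measurable (F : set (borel T)).
Proof.
move=> cF; rewrite -[F]setCK; apply: measurableC.
by apply: borel_measurable_open; exact: closed_openC.
Qed.

Lemma within_continuous_measurable (K : set T) (f : T -> R) :
  {within K, continuous f} -> measurable_fun (K : set (borel T)) f.
Proof.
move=> cf mK; apply: (measurability (RGenOInfty.G (R:=R))) => //.
  exact: RGenOInfty.measurableE.
move=> _ [_ [a ->] <-].
have /continuousP/(_ _ (@open_gt _ a))/open_subspaceP[V oV VK] := cf.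
rewrite setIC (_ : _ `&` K = V `&` K).
  by apply: measurableI => //; exact: borel_measurable_open.
rewrite VK; congr (_ `&` _); apply/seteqP; split => x /=.
  by rewrite in_itv /= andbT.
by rewrite in_itv /= andbT.
Qed.

Lemma cplx_continuous_measurable (K : set T) (f : T -> R[i]) :
  cplx_continuous K f -> cplx_measurable (K : set (borel T)) f.
Proof. by move=> [f1 f2]; split; exact: within_continuous_measurable. Qed.

Lemma within_continuous_bounded (K : set T) (f : T -> R) : compact K ->
  {within K, continuous f} -> [bounded f x | x in K].
Proof.
move=> cK cf; have /compact_bounded := continuous_compact cf cK.
move=> [M [Mr MP]]; exists M; split=> // N MN x Kx.
by apply: (MP N MN); exists x.
Qed.

Lemma cplx_continuous_bounded (K : set T) (f : T -> R[i]) : compact K ->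
  cplx_continuous K f -> cplx_bounded (K : set (borel T)) f.
Proof. by move=> cK [f1 f2]; split; exact: within_continuous_bounded. Qed.

Variables (m : {measure set (borel T) -> \bar R}) (K : set T).
Hypotheses (cK : compact K) (mK : measurable (K : set (borel T))).
Hypothesis finK : (m K < +oo)%E.

Lemma cplx_continuous_integrable (f : T -> R[i]) :
  cplx_continuous K f -> cplx_integrable m (K : set (borel T)) f.
Proof.
move=> cf; have [f1 f2] := cplx_continuous_measurable cf.
have [b1 b2] := cplx_continuous_bounded cK cf.
by split; exact: (measurable_bounded_integrable mK).
Qed.

Lemma cplx_continuous_L2 (f : T -> R[i]) :
  cplx_continuous K f -> L2 m (K : set (borel T)) f.
Proof.
move=> cf; have [f1 f2] := cplx_continuous_measurable cf; split=> //.
have [/integrableP[_ fin] _] :=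
  cplx_continuous_integrable (cplx_continuousM (cplx_continuousJ cf) cf).
apply: le_lt_trans fin; rewrite le_eqVlt; apply/orP; left; apply/eqP.
apply: eq_integral => x _; rewrite /= cReM cReJ cImJ mulNr opprK.
by rewrite ger0_norm// -!expr2 addr_ge0 ?sqr_ge0.
Qed.

End Borel.

(** * Translations and the compact picture *)

Section Translations.
Variable G : topologicalGroupType.

Lemma mulg_left_continuous (k : G) : continuous (fun x : G => (k * x)%g).
Proof.
move=> x; have kx : (fun y : G => (k, y)) @ x --> ((k, x) : G * G).
  by apply: cvg_pair; [exact: cvg_cst|exact: cvg_id].
exact: (cvg_comp _ _ kx (mulg_continuous (k, x))).
Qed.

Lemma mulg_right_continuous (k : G) : continuous (fun x : G => (x * k)%g).
Proof.
move=> x; have xk : (fun y : G => (y, k)) @ x --> ((x, k) : G * G).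
  by apply: cvg_pair; [exact: cvg_id|exact: cvg_cst].
exact: (cvg_comp _ _ xk (mulg_continuous (x, k))).
Qed.

Lemma continuous_borel_measurable (T : ptopologicalType) (t : T -> T) :
  continuous t -> measurable_fun [set: borel T] (t : borel T -> borel T).
Proof.
move=> /continuousP ct.
have := @measurability _ _ (borel T) (borel T) setT t (@open T) erefl.
apply => _ [U oU <-]; rewrite setTI; apply: borel_measurable_open; exact: ct.
Qed.

Variable Gamma : set G.
Local Notation X := (coset_space Gamma).

Lemma coset_of_elt_repr (x : X) : coset_of_elt Gamma (repr x) = x.
Proof. exact: reprK. Qed.

Lemma right_cosetM (x k : G) :
  right_coset Gamma (x * k)%g = [set (y * k)%g | y in right_coset Gamma x].
Proof.
apply/seteqP; split=> [_ [h Hh <-]|_ [_ [h Hh <-] <-]].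
  by exists (h * x)%g; [exists h|rewrite mulgA].
by exists h => //; rewrite mulgA.
Qed.

Lemma coset_eqP (x y : G) : coset_of_elt Gamma x = coset_of_elt Gamma y <->
  right_coset Gamma x = right_coset Gamma y.
Proof.
by split=> [/eqmodP/asboolP|xy]; last exact/eqmodP/asboolP.
Qed.

Lemma coset_act_elt (g k : G) :
  coset_act (coset_of_elt Gamma g) k = coset_of_elt Gamma (g * k)%g.
Proof.
apply/coset_eqP; rewrite !right_cosetM; congr image.
by apply/coset_eqP; rewrite coset_of_elt_repr.
Qed.

Lemma coset_actK (k : G) (x : X) : coset_act (coset_act x k) (k^-1)%g = x.
Proof.
by rewrite -{2}[x]coset_of_elt_repr -[x in LHS]coset_of_elt_repr !coset_act_elt mulgK.
Qed.

(** [coset_act] is defined through [repr], which need not be continuous; but g |-> Gamma g k is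
    continuous on G and constant on cosets, so it descends to the quotient. *)
Lemma coset_act_continuous (k : G) : continuous (fun x : X => coset_act x k).
Proof.
have -> : (fun x : X => coset_act x k) =
    ((fun g => coset_of_elt Gamma (g * k)%g) \o repr) by [].
apply: repr_comp_continuous => [g|a b /eqP ab].
  exact: (cvg_comp _ _ (mulg_right_continuous (k := k) (x := g)) (@pi_continuous _ _ _)).
by rewrite -!coset_act_elt; apply/eqP; congr coset_act.
Qed.

Lemma measurable_fun_coset_act (k : G) :
  measurable_fun [set: borel X] (fun x : borel X => coset_act (x : X) k : borel X).
Proof. exact: (@continuous_borel_measurable X _ (@coset_act_continuous k)). Qed.

Variables (R : realType) (mu : {measure set (borel X) -> \bar R}).
Hypothesis mu_invariant : invariant_measure mu.

Lemma cint_coset_act (k : G) (f : X -> R[i]) :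
  cplx_measurable [set: borel X] f ->
  cint mu [set: borel X] (fun x : borel X => f (coset_act (x : X) k)) =
  cint mu [set: borel X] f.
Proof.
move=> mf; apply: (@cint_measure_preserving _ _ (borel X) mu setT
  (fun x => coset_act (x : X) k)) => //.
- exact: measurable_fun_coset_act.
(* Invariance is stated for direct images; the preimage of B under translation by k is its direct
   image under translation by the inverse of k. *)
- move=> B mB; have [_ _ inv] := mu_invariant; rewrite -[RHS](inv (k^-1)%g)//.
  congr (mu _); apply/seteqP; split=> [x Bx|_ [x Bx <-]] /=.
    by exists (coset_act (x : X) k) => //; rewrite coset_actK.
  by rewrite -{2}[k]invgK coset_actK.
Qed.

Lemma measurable_coset_act (k : G) (f : X -> R[i]) :
  cplx_measurable [set: borel X] f ->
  cplx_measurable [set: borel X] (fun x : borel X => f (coset_act (x : X) k)).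
Proof.
move=> [f1 f2]; split.
  exact: (measurableT_comp f1 (measurable_fun_coset_act k)).
exact: (measurableT_comp f2 (measurable_fun_coset_act k)).
Qed.

End Translations.

Section CompactPicture.
Variables (R : realType) (G : topologicalGroupType) (n : nat).
Variables (L : lie_structure R G n) (K : set G).
Hypothesis K_maximal : maximal_compact_subgroup K.
Variable I : iwasawa L K.
Local Notation C := R[i].

Lemma max_compact1 : K 1%g. Proof. by have [[]] := K_maximal. Qed.

Lemma max_compactM x y : K x -> K y -> K (x * y)%g.
Proof. by have [[_ KM _] _ _] := K_maximal; exact: KM. Qed.

Lemma max_compactV x : K x -> K (x^-1)%g.
Proof. by have [[_ _ KV] _ _] := K_maximal; exact: KV. Qed.

Lemma max_compact_compact : compact K. Proof. by have [] := K_maximal. Qed.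

Lemma max_compact_measurable : measurable (K : set (borel G)).
Proof.
apply: borel_measurable_closed; apply: compact_closed max_compact_compact.
exact: lie_hausdorff L.
Qed.

Lemma iwa_M_sub h : iwa_M I h -> K h. Proof. by case. Qed.

Lemma iwa_MV h : iwa_M I h -> iwa_M I (h^-1)%g.
Proof.
move=> [Kh hA]; split; first exact: max_compactV.
by move=> a /hA ha; rewrite -[LHS](mulgK h) -(mulgA _ a) -ha mulKg.
Qed.

Lemma is_exp0 : is_exp L 0 1%g.
Proof.
exists (fun=> 1%g) => //; split=> [s t||].
- by rewrite mulg1.
- by move=> x; exact: cvg_cst.
- exact: is_derive_cst.
Qed.

Lemma iwa_A1 : iwa_A I 1%g. Proof. by exists 0; [exact: mem0v|exact: is_exp0]. Qed.
Lemma iwa_N1 : iwa_N I 1%g. Proof. by exists 0; [exact: mem0v|exact: is_exp0]. Qed.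

Lemma iwa_k_id k : K k -> iwa_k I k = k.
Proof.
by move=> Kk; have [] := iwa_uniq Kk iwa_A1 iwa_N1; rewrite !mulg1.
Qed.

Lemma iwa_a_id k : K k -> iwa_a I k = 1%g.
Proof.
by move=> Kk; have [] := iwa_uniq Kk iwa_A1 iwa_N1; rewrite !mulg1.
Qed.

(** The difference quotients vanish identically, whatever [f] is; this gives ad(0) = 0, hence rho(0)
    = 0. *)
Lemma derive_along0 (V W : normedModType R) (f : V -> W) x : 'D_0 f x = 0.
Proof.
rewrite /derive; apply/norm_cvg_lim => //.
under eq_fun do rewrite scaler0 /= add0r subrr scaler0.
exact: cvg_cst.
Qed.

Lemma apow1 (lambda : astar I) :
  apow (I := I) 1%g (fun H => 'i * (dual_app lambda H)%:C%C - (rho H)%:C%C) = 1.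
Proof.
rewrite /apow (_ : iwa_log I 1%g = 0); last first.
  by apply: iwa_logP; rewrite linear0; exact: is_exp0.
have -> : dual_app lambda 0 = 0 by rewrite /dual_app linear0.
have -> : rho (0 : subvs_of (aa I)) = 0.
  rewrite /rho big1 ?mulr0// => j _.
  by rewrite linear0 /ad derive_along0 linear0.
rewrite mulr0 subr0 /cexp /= expR0 cos0 sin0 mulr1 mulr0.
by [].
Qed.

(** The A-component of an element of K is 1, so the factor carrying [lambda] is 1 and K acts by left
    translation in every principal series. *)
Lemma principal_action_K q (lambda : astar I) (phi : G -> 'cV[C]_q) k k' :
  K k -> K k' -> principal_action lambda k phi k' = phi (k^-1 * k')%g.
Proof.
move=> Kk Kk'; have Kkk : K (k^-1 * k')%g.
  by apply: max_compactM => //; exact: max_compactV.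
by rewrite /principal_action iwa_a_id// iwa_k_id// apow1 scale1r.
Qed.

Variable haar : {measure set (borel G) -> \bar R}.
Hypothesis haar_K : haar_measure K haar.

Lemma haar_finite : (haar K < +oo)%E.
Proof. by have [-> _ _] := haar_K; exact: ltry. Qed.

Lemma cint_haar_cst (c : C) : cint haar K (fun=> c) = c.
Proof.
have [hK _ _] := haar_K.
rewrite /cint; apply: eq_cplx => /=;
  by rewrite Rintegral_cst ?hK ?mulr1//; exact: max_compact_measurable.
Qed.

Lemma cint_haar_translate k (f : G -> C) : K k -> cplx_continuous K f ->
  cint haar K (fun x : borel G => f (k * (x : G))%g) =
  cint haar K (f : borel G -> C).
Proof.
move=> Kk cf; apply: (@cint_measure_preserving _ _ (borel G) haar K
  (fun x => (k * (x : G))%g)).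
- exact: max_compact_measurable.
- exact: (@continuous_borel_measurable G _ (@mulg_left_continuous G k)).
- move=> B mB; have [_ _ inv] := haar_K; 
  rewrite -[RHS](inv (k^-1)%g)//; last exact: max_compactV.
  congr (haar _); apply/seteqP; split=> [x Bx|_ [x Bx <-]] /=.
    by exists (k * (x : G))%g => //; rewrite mulKg.
  by rewrite mulVKg.
- apply/seteqP; split=> [x Bx|x Kx] /=; last exact: max_compactM.
  by rewrite -[x](mulKg k); apply: max_compactM => //; exact: max_compactV.
- exact: cplx_continuous_measurable.
Qed.

End CompactPicture.

(** * Averaging over K *)

Section Averaging.
Variables (R : realType) (G : topologicalGroupType) (n : nat).
Variables (L : lie_structure R G n) (K : set G).
Hypothesis K_maximal : maximal_compact_subgroup K.
Variable haar : {measure set (borel G) -> \bar R}.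
Hypothesis haar_K : haar_measure K haar.
Local Notation C := R[i].

Lemma max_compact_integrable (f : G -> C) :
  cplx_continuous K f -> cplx_integrable haar (K : set (borel G)) f.
Proof.
apply: cplx_continuous_integrable; first exact: (max_compact_compact K_maximal).
  exact: (max_compact_measurable L K_maximal).
exact: (haar_finite haar_K).
Qed.

Definition mx_mean a b (A : G -> 'M[C]_(a, b)) : 'M[C]_(a, b) :=
  \matrix_(i, j) cint haar K (fun k : borel G => A k i j).

(** An arbitrary linear form on matrices, given by its coefficients [c], commutes with the mean. *)
Lemma cint_linear_mean a b (A : G -> 'M[C]_(a, b)) (c : 'I_a -> 'I_b -> C) :
  mx_continuous K A ->
  cint haar K (fun k : borel G => \sum_i \sum_j c i j * A k i j) =
  \sum_i \sum_j c i j * mx_mean A i j.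
Proof.
move=> cA; have mK := max_compact_measurable L K_maximal.
have cij i j : cplx_integrable haar (K : set (borel G)) (fun k => c i j * A k i j).
  by apply: cplx_integrableZ => //; apply: max_compact_integrable; exact: cA.
rewrite cint_sum// => [|i]; last exact: cplx_integrable_sum.
apply: eq_bigr => i _; rewrite cint_sum//; apply: eq_bigr => j _.
by rewrite cintZ ?mxE//; apply: max_compact_integrable; exact: cA.
Qed.

Lemma mx_mean_mul a b a' b' (B : 'M[C]_(a', a)) (A : G -> 'M[C]_(a, b))
    (D : 'M[C]_(b, b')) : mx_continuous K A ->
  mx_mean (fun k => B *m A k *m D) = B *m mx_mean A *m D.
Proof.
move=> cA; apply/matrixP => i j.
have E (X : 'M[C]_(a, b)) : (B *m X *m D) i j =
    \sum_s \sum_t (B i s * D t j) * X s t.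
  rewrite mxE exchange_big /=; apply: eq_bigr => t _.
  by rewrite mxE big_distrl /=; apply: eq_bigr => s _; rewrite mulrAC.
rewrite E -cint_linear_mean// mxE; apply: eq_cint => k _; exact: E.
Qed.

Lemma mx_mean_translate a b (A : G -> 'M[C]_(a, b)) k :
  mx_continuous K A -> K k -> mx_mean (fun x => A (k * x)%g) = mx_mean A.
Proof.
move=> cA Kk; apply/matrixP => i j; rewrite !mxE.
exact: (cint_haar_translate L K_maximal haar_K Kk (cA i j)).
Qed.

Lemma eq_mx_mean a b (A B : G -> 'M[C]_(a, b)) :
  (forall k, K k -> A k = B k) -> mx_mean A = mx_mean B.
Proof.
by move=> AB; apply/matrixP => i j; rewrite !mxE; apply: eq_cint => k Kk;
  rewrite AB.
Qed.

Variables (p d : nat) (gamma : G -> 'M[C]_p) (r : G -> 'M[C]_d).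
Hypotheses (gamma_rep : unitary_rep K gamma) (r_rep : unitary_rep K r).

(** The projection of [V] onto the K-invariants of [r] tensor [gamma], in the encoding of v tensor w
    as v w^T. *)
Definition rep_mean (V : 'M[C]_(d, p)) : 'M[C]_(d, p) :=
  mx_mean (fun k => r k *m V *m (gamma k)^T).

Lemma rep_mean_continuous V : mx_continuous K (fun k => r k *m V *m (gamma k)^T).
Proof.
have [_ _ cr] := r_rep; have [_ _ cg] := gamma_rep.
apply: mx_continuous_mul; last exact: mx_continuous_tr.
by apply: mx_continuous_mul => //; exact: mx_continuous_cst.
Qed.

(* That is, [rep_mean V] intertwines the conjugate of [gamma] with [r]. *)
Lemma rep_mean_invariant V k :
  K k -> r k *m rep_mean V *m (gamma k)^T = rep_mean V.
Proof.
move=> Kk; have [_ rM _] := r_rep; have [_ gM _] := gamma_rep.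
rewrite -mx_mean_mul; last exact: rep_mean_continuous.
rewrite -[RHS](mx_mean_translate _ Kk); last exact: rep_mean_continuous.
by apply: eq_mx_mean => k' Kk'; rewrite rM// gM// trmx_mul !mulmxA.
Qed.

(** A linear form on matrices is a combination of entries, so it passes under the integral over K;
    invariance makes the integrand constant, and K has total mass 1. *)
Lemma invariant_rep_mean (beta : 'M[C]_(d, p) -> C) :
  (forall c V W, beta (c *: V + W) = c * beta V + beta W) ->
  (forall V k, K k -> beta (r k *m V *m (gamma k)^T) = beta V) ->
  forall V, beta (rep_mean V) = beta V.
Proof.
move=> beta_lin beta_inv V.
have beta0 : beta 0 = 0.
  by have := beta_lin (-1) 0 0; rewrite scaler0 addr0 mulN1r addNr.
have betaD W W' : beta (W + W') = beta W + beta W'.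
  by rewrite -[W in LHS]scale1r beta_lin mul1r.
have betaZ c W : beta (c *: W) = c * beta W.
  by rewrite -[c *: W]addr0 beta_lin beta0 addr0.
have betaE W : beta W = \sum_i \sum_j beta (delta_mx i j) * W i j.
  rewrite {1}(matrix_sum_delta W) (big_morph beta betaD beta0).
  apply: eq_bigr => i _; rewrite (big_morph beta betaD beta0).
  by apply: eq_bigr => j _; rewrite betaZ mulrC.
rewrite betaE -cint_linear_mean.
  rewrite -[RHS](cint_haar_cst L K_maximal haar_K); apply: eq_cint => k Kk.
  by rewrite -betaE beta_inv.
exact: rep_mean_continuous.
Qed.

End Averaging.

(** * Embeddings of the principal series *)

Section Embedding.
Variables (R : realType) (G : topologicalGroupType) (n : nat).
Variables (L : lie_structure R G n) (K : set G).
Hypothesis K_maximal : maximal_compact_subgroup K.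
Variables (I : iwasawa L K) (Gamma : set G).
Local Notation X := (coset_space Gamma).
Variable mu : {measure set (borel X) -> \bar R}.
Hypothesis mu_invariant : invariant_measure mu.
Variable haar : {measure set (borel G) -> \bar R}.
Hypothesis haar_K : haar_measure K haar.
Variables (q : nat) (kappa : G -> 'M[R[i]]_q).
Local Notation C := R[i].

(** The width [m] is left free so as to cover vectors, sections tensored with V_gamma and the
    matrix-valued maps of an [intertwiner] alike. *)
Definition continuous_section m (phi : G -> 'M[C]_(q, m)) : Prop :=
  equivariant I kappa phi /\ mx_continuous K phi.

Lemma continuous_section_mul m m' (phi : G -> 'M[C]_(q, m))
    (V : 'M[C]_(m, m')) :
  continuous_section phi -> continuous_section (fun k => phi k *m V).
Proof.
move=> [e c]; split; first by move=> k h Kk Mh; rewrite e// mulmxA.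
by apply: mx_continuous_mul => //; exact: mx_continuous_cst.
Qed.

Lemma continuous_section_col m (phi : G -> 'M[C]_(q, m)) j :
  continuous_section phi -> continuous_section (fun k => col j (phi k)).
Proof. by under eq_fun do rewrite colE; exact: continuous_section_mul. Qed.

Lemma continuous_sectionD m (phi psi : G -> 'M[C]_(q, m)) :
  continuous_section phi -> continuous_section psi ->
  continuous_section (fun k => phi k + psi k).
Proof.
move=> [e1 c1] [e2 c2]; split.
  by move=> k h Kk Mh; rewrite e1// e2// mulmxDr.
move=> i j; suff: cplx_continuous K (fun x => (phi x + psi x) i j) by [].
by under eq_fun do rewrite mxE; apply: cplx_continuousD; [exact: c1|exact: c2].
Qed.

Lemma continuous_section0 m : continuous_section (fun=> 0 : 'M[C]_(q, m)).
Proof.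
split; first by move=> k h _ _; rewrite mulmx0.
exact: mx_continuous_cst.
Qed.

Lemma continuous_sectionZ m c (phi : G -> 'M[C]_(q, m)) :
  continuous_section phi -> continuous_section (fun k => c *: phi k).
Proof.
move=> /(continuous_section_mul c%:M).
by under eq_fun do rewrite mul_mx_scalar.
Qed.

Lemma continuous_section_sum (J : finType) m (phi : J -> G -> 'M[C]_(q, m)) :
  (forall j, continuous_section (phi j)) ->
  continuous_section (fun k => \sum_j phi j k).
Proof.
move=> phiP; rewrite (_ : (fun k => _) = \sum_j phi j); last first.
  by apply/funext => k; rewrite fct_sumE.
elim/big_ind: _ => [|f g|j _]; [exact: continuous_section0| |exact: phiP].
exact: continuous_sectionD.
Qed.

Lemma eq_continuous_section m (phi psi : G -> 'M[C]_(q, m)) :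
  (forall k, K k -> phi k = psi k) ->
  continuous_section phi -> continuous_section psi.
Proof.
move=> E [e c]; split.
  move=> k h Kk Mh; rewrite -E ?e -?E//.
  by apply: (max_compactM K_maximal) => //; exact: iwa_M_sub Mh.
move=> i j; apply: (eq_cplx_continuous _ (c i j)) => k Kk.
by rewrite E.
Qed.

Lemma continuous_section_series (phi : G -> 'cV[C]_q) :
  continuous_section phi -> principal_series I haar kappa phi.
Proof.
move=> [e c]; split=> // j; apply: cplx_continuous_L2; last exact: c.
- exact: (max_compact_compact K_maximal).
- exact: (max_compact_measurable L K_maximal).
- exact: (haar_finite haar_K).
Qed.

Variables (lambda : astar I) (xi : (G -> 'cV[C]_q) -> X -> C).
Hypothesis xiP : unitary_embedding mu haar kappa lambda xi.

Lemma embedding_lin c (phi psi : G -> 'cV[C]_q) :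
  continuous_section phi -> continuous_section psi ->
  {ae mu, forall x : borel X,
    xi (fun k => c *: phi k + psi k) x = c * xi phi x + xi psi x}.
Proof.
have [_ xilin _ _] := xiP.
by move=> cp cs; apply: xilin; exact: continuous_section_series.
Qed.

(** The norm of the principal series integrates over K only, so [phi] has norm 0, and the isometry
    gives [xi phi] norm 0. Applied to differences, this makes [xi] insensitive to values off K. *)
Lemma embedding_ae0 (phi : G -> 'cV[C]_q) : continuous_section phi ->
  (forall k, K k -> phi k = 0) -> {ae mu, forall x : borel X, xi phi x = 0}.
Proof.
move=> cp p0; have [xiL2 _ iso _] := xiP.
have ps := continuous_section_series cp.
apply: (L2_ae0 (xiL2 _ ps)); rewrite iso//.
transitivity (cint haar (K : set (borel G)) (fun=> 0)); last exact: cint0.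
by apply: eq_cint => k Kk; rewrite p0// mxdotE mulmx0 linear0.
Qed.

Lemma eq_embedding (phi psi : G -> 'cV[C]_q) : continuous_section phi ->
  (forall k, K k -> phi k = psi k) ->
  {ae mu, forall x : borel X, xi phi x = xi psi x}.
Proof.
move=> cp E; have cs := eq_continuous_section E cp.
have cd := continuous_sectionD (continuous_sectionZ (-1) cs) cp.
have d0 : {ae mu, forall x : borel X,
    xi (fun k => -1 *: psi k + phi k) x = 0}.
  by apply: embedding_ae0 => // k Kk; rewrite E// scaleN1r addNr.
apply: filterS2 (embedding_lin (-1) cs cp) d0 => x -> /eqP.
by rewrite mulN1r addrC subr_eq0 => /eqP.
Qed.

Lemma embedding_sum (J : finType) (c : J -> C) (phi : J -> G -> 'cV[C]_q) :
  (forall j, continuous_section (phi j)) ->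
  {ae mu, forall x : borel X,
    xi (fun k => \sum_j c j *: phi j k) x = \sum_j c j * xi (phi j) x}.
Proof.
move=> phiP.
rewrite (_ : (fun k => _) =
  (fun k => (\sum_j (fun k => c j *: phi j k)) k)); last first.
  by apply/funext => k; rewrite fct_sumE.
have cc j := continuous_sectionZ (c j) (phiP j).
suff [] : continuous_section (\sum_j (fun k => c j *: phi j k)) /\
  {ae mu, forall x : borel X, xi (\sum_j (fun k => c j *: phi j k)) x =
    (\sum_j (fun x => c j * xi (phi j) x)) x}.
  by move=> _; apply: filterS => x ->; rewrite fct_sumE.
elim: (index_enum J) => [|j s [IH1 IH2]].
  rewrite !big_nil; split; first exact: continuous_section0.
  by apply: embedding_ae0 => //; exact: continuous_section0.
rewrite !big_cons; split; first exact: continuous_sectionD.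
apply: filterS2 IH2 (embedding_lin (c j) (phiP j) IH1) => x E.
by rewrite /= E.
Qed.

Lemma xi_tensor_lin m c (phi psi : G -> 'M[C]_(q, m)) :
  continuous_section phi -> continuous_section psi ->
  {ae mu, forall x : borel X,
    xi_tensor xi (fun k => c *: phi k + psi k) x =
    c *: xi_tensor xi phi x + xi_tensor xi psi x}.
Proof.
move=> phiP psiP.
have : {ae mu, forall x : borel X, forall a : 'I_m,
  xi (fun k => c *: col a (phi k) + col a (psi k)) x =
  c * xi (fun k => col a (phi k)) x + xi (fun k => col a (psi k)) x}.
  by apply: filter_forall => a; apply: embedding_lin; exact: continuous_section_col.
apply: filterS => x E; apply/colP => a; rewrite !mxE -E.
by congr (xi _ x); apply/funext => k; rewrite linearP.
Qed.

(** Right multiplication by [V] acts on the factor V_gamma, where it is V^T because v tensor w is v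
    w^T, while [xi] acts on the other factor. *)
Lemma xi_tensor_mul m m' (phi : G -> 'M[C]_(q, m)) (V : 'M[C]_(m, m')) :
  continuous_section phi ->
  {ae mu, forall x : borel X,
    xi_tensor xi (fun k => phi k *m V) x = V^T *m xi_tensor xi phi x}.
Proof.
move=> phiP.
have : {ae mu, forall x : borel X, forall b : 'I_m',
  xi (fun k => \sum_a V a b *: col a (phi k)) x =
  \sum_a V a b * xi (fun k => col a (phi k)) x}.
  apply: filter_forall => b; apply: embedding_sum => a.
  exact: continuous_section_col.
apply: filterS => x E; apply/colP => b; rewrite !mxE.
have -> : (fun k => col b (phi k *m V)) = (fun k => \sum_a V a b *: col a (phi k)).
  apply/funext => k; apply/colP => i; rewrite !mxE summxE.
  by apply: eq_bigr => a _; rewrite !mxE mulrC.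
by rewrite E; apply: eq_bigr => a _; rewrite !mxE.
Qed.

Lemma eq_xi_tensor m (phi psi : G -> 'M[C]_(q, m)) : continuous_section phi ->
  (forall k, K k -> phi k = psi k) ->
  {ae mu, forall x : borel X, xi_tensor xi phi x = xi_tensor xi psi x}.
Proof.
move=> phiP E.
have : {ae mu, forall x : borel X, forall a : 'I_m,
  xi (fun k => col a (phi k)) x = xi (fun k => col a (psi k)) x}.
  apply: filter_forall => a; apply: eq_embedding.
    exact: continuous_section_col.
  by move=> k Kk; rewrite E.
by apply: filterS => x Ex; apply/colP => a; rewrite !mxE.
Qed.

Lemma xi_tensor_translate m (phi phi' : G -> 'M[C]_(q, m)) k : K k ->
  continuous_section phi -> continuous_section phi' ->
  (forall k', K k' -> phi' k' = phi (k^-1 * k')%g) ->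
  {ae mu, forall x : borel X,
    xi_tensor xi phi' x = xi_tensor xi phi (coset_act (x : X) k)}.
Proof.
move=> Kk phiP phiP' E; have [_ _ _ xiG] := xiP.
have : {ae mu, forall x : borel X, forall a : 'I_m,
  xi (fun k => col a (phi' k)) x =
  xi (fun k => col a (phi k)) (coset_act (x : X) k)}.
  apply: filter_forall => a.
  have ca := continuous_section_col a phiP.
  have eqa : {ae mu, forall x : borel X, xi (fun k => col a (phi' k)) x =
      xi (principal_action lambda k (fun k => col a (phi k))) x}.
    apply: eq_embedding; first exact: continuous_section_col.
    by move=> k' Kk'; rewrite principal_action_K// E.
  apply: filterS2 eqa (xiG k _ (continuous_section_series ca)) => x -> ->.
  by [].
by apply: filterS => x Ex; apply/colP => a; rewrite !mxE.
Qed.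

Lemma xi_tensor_L2 m (phi : G -> 'M[C]_(q, m)) a : continuous_section phi ->
  L2 mu setT (fun x : borel X => xi_tensor xi phi x a 0).
Proof.
move=> phiP; have [xiL2 _ _ _] := xiP.
have := xiL2 _ (continuous_section_series (continuous_section_col a phiP)).
rewrite (_ : (fun x : borel X => xi_tensor xi phi x a 0) =
  (fun x : borel X => xi (fun k => col a (phi k)) x))//.
by apply/funext => x; rewrite mxE.
Qed.

End Embedding.

(** * K-invariance of the functionals and reduction to invariant sections *)

Section MatrixCoefficients.
Variables (R : realType) (G : topologicalGroupType) (n : nat).
Variables (L : lie_structure R G n) (K : set G).
Hypothesis K_maximal : maximal_compact_subgroup K.
Variables (I : iwasawa L K) (Gamma : set G).
Local Notation X := (coset_space Gamma).
Hypothesis Gamma_cocompact : compact [set: X].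
Variable mu : {measure set (borel X) -> \bar R}.
Hypothesis mu_invariant : invariant_measure mu.
Variable haar : {measure set (borel G) -> \bar R}.
Hypothesis haar_K : haar_measure K haar.
Variables (q : nat) (kappa : G -> 'M[R[i]]_q).
Variables (p : nat) (gamma : G -> 'M[R[i]]_p).
Hypothesis gamma_rep : unitary_rep K gamma.
Local Notation C := R[i].
Local Notation section := (continuous_section I kappa).

(** By compactness of Gamma \ G the entries of [A] are bounded, and they multiply products of two
    square-integrable functions. *)
Lemma mxdot_integrable m (u : X -> 'cV[C]_p) (A : X -> 'M[C]_(p, m))
    (w : X -> 'cV[C]_m) :
  (forall i, L2 mu setT (fun x : borel X => u x i 0)) ->
  (forall j, L2 mu setT (fun x : borel X => w x j 0)) ->
  mx_continuous setT A ->
  cplx_integrable mu setT (fun x : borel X => mxdot (u x) (A x *m w x)).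
Proof.
move=> uL wL cA; under eq_fun do rewrite mxdot_mulE.
apply: cplx_integrable_sum => // i; apply: cplx_integrable_sum => // j.
apply: cplx_integrable_bounded => //.
- exact: cplx_continuous_measurable (cA i j).
- exact: cplx_continuous_bounded Gamma_cocompact (cA i j).
- exact: L2_integrable_mul.
Qed.

Variables (lambda : astar I) (xi : (G -> 'cV[C]_q) -> X -> C).
Hypothesis xiP : unitary_embedding mu haar kappa lambda xi.

Lemma sigma_xi_integrable (f : X -> 'M[C]_p) (phi psi : G -> 'M[C]_(q, p)) :
  A_gamma f -> section phi -> section psi ->
  cplx_integrable mu setT (fun x : borel X =>
    mxdot (xi_tensor xi phi x) (f x *m xi_tensor xi psi x)).
Proof.
move=> cf phiP psiP; apply: mxdot_integrable => // i.
- exact: (xi_tensor_L2 K_maximal haar_K xiP).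
- exact: (xi_tensor_L2 K_maximal haar_K xiP).
Qed.

Lemma sigma_xi_lin (f : X -> 'M[C]_p) c (phi psi psi' : G -> 'M[C]_(q, p)) :
  A_gamma f -> section phi -> section psi -> section psi' ->
  sigma_xi mu xi phi (fun k => c *: psi k + psi' k) f =
  c * sigma_xi mu xi phi psi f + sigma_xi mu xi phi psi' f.
Proof.
move=> cf phiP psiP psiP'; rewrite /sigma_xi -cintZ//;
  last exact: sigma_xi_integrable.
have i1 := sigma_xi_integrable cf phiP psiP.
have i2 := sigma_xi_integrable cf phiP psiP'.
have i12 := cplx_integrableZ measurableT c i1.
rewrite -(cintD measurableT i12 i2).
apply: (ae_eq_cint measurableT).
- apply: cplx_integrable_measurable; apply: sigma_xi_integrable => //.
  by apply: continuous_sectionD => //; exact: continuous_sectionZ.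
- exact: (cplx_integrable_measurable (cplx_integrableD measurableT i12 i2)).
apply: filterS (xi_tensor_lin K_maximal haar_K xiP c psiP psiP') => x ->.
by rewrite mulmxDr mxdotDr -scalemxAr mxdotZr.
Qed.

Lemma eq_sigma_xi (f : X -> 'M[C]_p) (phi phi' psi psi' : G -> 'M[C]_(q, p)) :
  A_gamma f -> section phi -> section psi ->
  (forall k, K k -> phi k = phi' k) -> (forall k, K k -> psi k = psi' k) ->
  sigma_xi mu xi phi psi f = sigma_xi mu xi phi' psi' f.
Proof.
move=> cf phiP psiP E E'; apply: (ae_eq_cint measurableT).
- by apply: cplx_integrable_measurable; exact: sigma_xi_integrable.
- apply: cplx_integrable_measurable; apply: sigma_xi_integrable => //.
    exact: (eq_continuous_section K_maximal E phiP).
  exact: (eq_continuous_section K_maximal E' psiP).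
by apply: filterS2 (eq_xi_tensor K_maximal haar_K xiP phiP E)
  (eq_xi_tensor K_maximal haar_K xiP psiP E') => x -> ->.
Qed.

Lemma sigma_xi_sum (f : X -> 'M[C]_p) (J : finType) (phi : G -> 'M[C]_(q, p))
    (psi : J -> G -> 'M[C]_(q, p)) (P : pred J) :
  A_gamma f -> section phi -> (forall j, section (psi j)) ->
  sigma_xi mu xi phi (fun k => \sum_(j | P j) psi j k) f =
  \sum_(j | P j) sigma_xi mu xi phi (psi j) f.
Proof.
move=> cf phiP psiP; rewrite (_ : (fun k => _) = \sum_(j | P j) psi j); last first.
  by apply/funext => k; rewrite fct_sumE.
(* Linearity is available for continuous sections only, so continuity of the partial sums is carried
   through the induction. *)
suff [] : section (\sum_(j | P j) psi j) /\
  sigma_xi mu xi phi (\sum_(j | P j) psi j) f =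
  \sum_(j | P j) sigma_xi mu xi phi (psi j) f by [].
have s0 := @continuous_section0 R G n L K I q kappa p.
apply: (big_ind2 (fun g z => section g /\ sigma_xi mu xi phi g f = z)).
(* The value on the zero section is 0: linearity with c = -1 and both sections zero. *)
- split=> //; have := sigma_xi_lin (-1) cf phiP s0 s0.
  rewrite mulN1r addNr => E; rewrite -[RHS]E; congr (sigma_xi mu xi phi _ f).
  by apply/funext => k; rewrite scaler0 addr0.
- move=> g z h w [gP <-] [hP <-]; split; first exact: continuous_sectionD.
  rewrite -[X in _ = X + _]mul1r -(sigma_xi_lin 1 cf phiP gP hP).
  congr (sigma_xi mu xi phi _ f).
  by apply/funext => k; rewrite scale1r.
- by move=> j _.
Qed.

Lemma gammaV k : K k ->
  gamma (k^-1)%g = (gamma k)^t* /\ invmx (gamma k) = (gamma k)^t*.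
Proof.
move=> Kk; have [gu _ _] := gamma_rep; rewrite (invmx_unitary (gu _ Kk)).
have sK : is_subgroup K by have [] := K_maximal.
split=> //; rewrite -(invmx_unitary (gu _ Kk)).
have [_ gV] := unitary_repV sK gamma_rep Kk.
by rewrite -[LHS](mulmxK (unitarymx_unit (gu _ Kk))) gV mul1mx.
Qed.

Lemma gamma_adjK k : K k -> (gamma k)^t* *m gamma k = 1%:M.
Proof.
by move=> Kk; apply: mulmx1C; apply/unitarymxP; have [gu _ _] := gamma_rep; exact: gu.
Qed.

Lemma A_gamma_invariant_act (f : X -> 'M[C]_p) k (x : X) : K k ->
  A_gamma_invariant K gamma f ->
  f (coset_act x k) = (gamma k)^t* *m f x *m gamma k.
Proof.
move=> Kk [_ /(_ (repr x) k Kk)]; rewrite coset_of_elt_repr => <-.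
have [_ ->] := gammaV Kk; rewrite !mulmxA gamma_adjK// mul1mx -mulmxA.
by rewrite gamma_adjK// mulmx1.
Qed.

(* [phi'] is the translate of [phi] by [k] under the tensor product of the
   principal series and [gamma]. *)
Lemma xi_tensor_gamma k (phi phi' : G -> 'M[C]_(q, p)) : K k ->
  section phi -> section phi' ->
  (forall k', K k' -> phi' k' = phi (k^-1 * k')%g *m (gamma k)^T) ->
  {ae mu, forall x : borel X,
    xi_tensor xi phi' x = gamma k *m xi_tensor xi phi (coset_act (x : X) k)}.
Proof.
move=> Kk phiP phiP' E.
have gg : (gamma k)^T *m ((gamma k)^t* )^T = 1%:M.
  by rewrite -trmx_mul gamma_adjK// trmx1.
pose phi'' k' := phi' k' *m ((gamma k)^t* )^T.
have phiP'' : section phi'' by exact: continuous_section_mul.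
have E'' k' : K k' -> phi'' k' = phi (k^-1 * k')%g.
  by move=> Kk'; rewrite /phi'' E// -mulmxA gg mulmx1.
have := xi_tensor_mul K_maximal haar_K xiP ((gamma k)^t* )^T phiP'.
apply: filterS2 (xi_tensor_translate K_maximal haar_K xiP Kk phiP phiP'' E'')
  => x <-.
rewrite trmxK => ->; rewrite mulmxA.
have [gu _ _] := gamma_rep; have /unitarymxP -> := gu _ Kk.
by rewrite mul1mx.
Qed.

(** The two factors gamma(k) coming from the translated sections turn f(x) into f(xk), by
    K-invariance of [f]; the whole integrand is then translated by k, and the measure is
    invariant. *)
Lemma sigma_xi_translate (f : X -> 'M[C]_p) k
    (phi psi phi' psi' : G -> 'M[C]_(q, p)) :
  A_gamma_invariant K gamma f -> K k ->
  section phi -> section psi -> section phi' -> section psi' ->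
  (forall k', K k' -> phi' k' = phi (k^-1 * k')%g *m (gamma k)^T) ->
  (forall k', K k' -> psi' k' = psi (k^-1 * k')%g *m (gamma k)^T) ->
  sigma_xi mu xi phi' psi' f = sigma_xi mu xi phi psi f.
Proof.
move=> fP Kk phiP psiP phiP' psiP' Ephi Epsi; have [cf _] := fP.
have mS := cplx_integrable_measurable (sigma_xi_integrable cf phiP psiP).
rewrite /sigma_xi -(cint_coset_act mu_invariant k mS).
apply: (ae_eq_cint measurableT).
- by apply: cplx_integrable_measurable; exact: sigma_xi_integrable.
- exact: (measurable_coset_act k mS).
apply: filterS2 (xi_tensor_gamma Kk phiP phiP' Ephi)
  (xi_tensor_gamma Kk psiP psiP' Epsi) => x -> ->.
by rewrite mxdotMl (A_gamma_invariant_act _ Kk fP) !mulmxA.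
Qed.

(** K-invariance of psi_S under the diagonal action, in the form expected by
    [sigma_xi_translate]. *)
Lemma psi_T_translate S k k' : K k -> K k' ->
  psi_T (q := q) gamma S k' = psi_T gamma S (k^-1 * k')%g *m (gamma k)^T.
Proof.
move=> Kk Kk'; have [_ gM _] := gamma_rep.
have Kkk : K (k^-1 * k')%g.
  by apply: (max_compactM K_maximal) => //; exact: (max_compactV K_maximal).
by rewrite /psi_T -mulmxA -trmx_mul -gM// mulVKg.
Qed.

(** M-invariance amounts to S gamma(h)^T = kappa(h^-1) S, which is the equivariance of psi_S. *)
Lemma psi_T_section S : M_invariant I gamma kappa S -> section (psi_T gamma S).
Proof.
move=> SM; have [_ gM cg] := gamma_rep; split; last first.
  apply: mx_continuous_mul; first exact: mx_continuous_cst.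
  exact: mx_continuous_tr.
move=> k h Kk Mh; have Kh := iwa_M_sub Mh.
have sK : is_subgroup K by have [] := K_maximal.
have Sh : S *m (gamma h)^T = kappa (h^-1)%g *m S.
  rewrite -{1}(SM _ (iwa_MV K_maximal Mh)) -mulmxA -trmx_mul.
  by have [-> _] := unitary_repV sK gamma_rep Kh; rewrite trmx1 mulmx1.
by rewrite /psi_T gM// trmx_mul !mulmxA Sh.
Qed.

(** As a function of [V] the left side is a linear form; it is invariant because translating F V by
    k under the diagonal action gives F r(k) V gamma(k)^T, while psi_S is fixed. *)
Lemma sigma_xi_intertwiner_mean (f : X -> 'M[C]_p) (S : 'M[C]_(q, p)) d
    (r : G -> 'M[C]_d) (F : G -> 'M[C]_(q, d)) V :
  A_gamma_invariant K gamma f -> M_invariant I gamma kappa S ->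
  unitary_rep K r -> intertwiner I kappa r F ->
  sigma_xi mu xi (psi_T gamma S) (fun k => F k *m V) f =
  sigma_xi mu xi (psi_T gamma S)
    (fun k => F k *m rep_mean K haar gamma r V) f.
Proof.
move=> fP SM ru [Fe Fc FK]; have [cf _] := fP.
have FP (W : 'M[C]_(d, p)) : section (fun k => F k *m W).
  exact: continuous_section_mul.
pose beta (W : 'M[C]_(d, p)) :=
  sigma_xi mu xi (psi_T gamma S) (fun k => F k *m W) f.
apply/esym; rewrite -/(beta V) -/(beta _).
apply: (invariant_rep_mean L K_maximal haar_K gamma_rep ru) => [c W W'|W k Kk].
  rewrite /beta -(sigma_xi_lin c cf (psi_T_section SM) (FP W) (FP W')).
  congr (sigma_xi mu xi _ _ f); apply/funext => k.
  by rewrite mulmxDr -scalemxAr.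
apply: (@sigma_xi_translate f k) => //; try exact: psi_T_section.
- by move=> k' Kk'; exact: psi_T_translate.
- by move=> k' Kk'; rewrite FK// !mulmxA.
Qed.

Lemma intertwiner1 d (r : G -> 'M[C]_d) (F : G -> 'M[C]_(q, d)) k :
  intertwiner I kappa r F -> K k -> F k = F 1%g *m r (k^-1)%g.
Proof.
move=> [_ _ FK] Kk.
by rewrite -FK ?invgK ?mulg1//;
  [exact: (max_compactV K_maximal)|exact: (max_compact1 K_maximal)].
Qed.

Section Mean.
Variables (d : nat) (r : G -> 'M[C]_d) (F : G -> 'M[C]_(q, d)).
Hypotheses (ru : unitary_rep K r) (FP : intertwiner I kappa r F).

(** F(k) = F(1) r(k^-1), and the mean Q satisfies r(k^-1) Q = Q gamma(k)^T. Thus averaging an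
    isotypic section produces some psi_S with S read off at 1. *)
Lemma intertwiner_meanE V k : K k -> F k *m rep_mean K haar gamma r V =
  psi_T gamma (F 1%g *m rep_mean K haar gamma r V) k.
Proof.
move=> Kk; have KkV : K (k^-1)%g by exact: (max_compactV K_maximal).
have sK : is_subgroup K by have [] := K_maximal.
rewrite (intertwiner1 FP Kk) /psi_T -mulmxA -mulmxA; congr (_ *m _).
rewrite -[X in _ = X *m _](rep_mean_invariant L K_maximal haar_K gamma_rep ru V KkV).
rewrite -[RHS]mulmxA -trmx_mul.
by have [-> _] := unitary_repV sK gamma_rep Kk; rewrite trmx1 mulmx1.
Qed.

Lemma intertwiner_mean_M_invariant V :
  M_invariant I gamma kappa (F 1%g *m rep_mean K haar gamma r V).
Proof.
move=> h Mh; have Kh := iwa_M_sub Mh; have [Fe _ FK] := FP.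
have E : kappa h *m F 1%g = F 1%g *m r h.
  rewrite -[h in kappa h]invgK -Fe; last exact: (iwa_MV K_maximal).
    by rewrite mul1g -(FK _ _ Kh (max_compact1 K_maximal)) mulg1.
  exact: (max_compact1 K_maximal).
rewrite mulmxA E -!mulmxA; congr (_ *m _); rewrite mulmxA.
exact: (rep_mean_invariant L K_maximal haar_K gamma_rep ru).
Qed.

(** The same averaging, applied to the inner product of sections; after it the integrand is
    constant, since gamma is unitary. *)
Lemma cint_intertwiner_mean S V : M_invariant I gamma kappa S ->
  cint haar K (fun k : borel G => mxdot (psi_T gamma S k) (F k *m V)) =
  mxdot S (F 1%g *m rep_mean K haar gamma r V).
Proof.
move=> SM; have [Fe Fc FK] := FP.
pose h (W : 'M[C]_(d, p)) k := mxdot (psi_T gamma S k) (F k *m W).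
pose beta W := cint haar K (h W : borel G -> C).
have hc W : cplx_continuous K (h W).
  have [_ cS] := psi_T_section SM.
  apply: mx_continuous_mxdot => //.
  by apply: mx_continuous_mul => //; exact: mx_continuous_cst.
have mK := max_compact_measurable L K_maximal.
rewrite -/(h V) -/(beta V).
rewrite -(invariant_rep_mean L K_maximal haar_K gamma_rep ru (beta := beta)).
- rewrite -[RHS](cint_haar_cst L K_maximal haar_K); apply: eq_cint => k Kk.
  rewrite /h (intertwiner_meanE V Kk) /psi_T; apply: mxdotMM.
  by rewrite -map_trmx -trmx_mul gamma_adjK// trmx1.
- move=> c W W'; have iW := max_compact_integrable L K_maximal haar_K (hc W).
  have iW' := max_compact_integrable L K_maximal haar_K (hc W').
  rewrite /beta -(cintZ mK c iW) -(cintD mK (cplx_integrableZ mK c iW) iW').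
  apply: eq_cint => k Kk.
  by rewrite /h mulmxDr mxdotDr -scalemxAr mxdotZr.
- move=> W k Kk; have KkV : K (k^-1)%g by exact: (max_compactV K_maximal).
  rewrite /beta -[RHS](cint_haar_translate L K_maximal haar_K KkV (hc W)).
  apply: eq_cint => k' Kk'.
  rewrite /h (psi_T_translate S Kk Kk') FK// !mulmxA; apply: mxdotMM.
  by rewrite -map_trmx -trmx_mul gamma_adjK// trmx1.
Qed.

End Mean.
End MatrixCoefficients.

(** * Isotypic components of the delta distribution *)

Section ComplexLimits.
Variable R : realType.
Local Notation C := R[i].

Lemma cvgCD (u v : nat -> C) z w : cvgC u z -> cvgC v w ->
  cvgC (fun k => u k + v k) (z + w).
Proof.
move=> [u1 u2] [v1 v2]; split.
  by under eq_fun do rewrite cReD; rewrite cReD; exact: cvgD.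
by under eq_fun do rewrite cImD; rewrite cImD; exact: cvgD.
Qed.

Lemma cvgC_sum (J : finType) (P : pred J) (u : J -> nat -> C) z :
  (forall j, cvgC (u j) (z j)) ->
  cvgC (fun k => \sum_(j | P j) u j k) (\sum_(j | P j) z j).
Proof.
move=> uz; rewrite (_ : (fun k => _) = \sum_(j | P j) u j); last first.
  by apply/funext => k; rewrite fct_sumE.
apply: (big_ind2 (fun v w => cvgC v w)) => [|v z1 w z2|j _].
- by split; exact: cvg_cst.
- exact: cvgCD.
- exact: uz.
Qed.

Lemma cvgC_lim (u : nat -> C) z : cvgC u z -> limC u = z.
Proof.
by move=> [u1 u2]; apply: eq_cplx; rewrite /= (cvg_lim _ u1, cvg_lim _ u2).
Qed.

End ComplexLimits.

(** Regroups the irreducible constituents by class. A class outside the image of [g] contributes an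
    empty sum, so the support is contained in a finite set and the sum over [D] is a genuine one. *)
Lemma fsbig_fibers (V : nmodType) (J : finType) (Cl : choiceType) (D : set Cl)
    (g : J -> Cl) (z : J -> V) : (forall j, D (g j)) ->
  \sum_(c \in D) \sum_(j | g j == c) z j = \sum_j z j.
Proof.
move=> Dg; rewrite -(fsbig_widen [set g j | j in setT]); first last.
- move=> c [Dc gc] /=; rewrite big_pred0// => j; apply/eqP => gj; apply: gc.
  by exists j.
- by move=> _ [j _ <-].
have fin : finite_set [set g j | j in [set: J]] by exact: finite_image.
rewrite fsbig_finite//= (exchange_big_dep xpredT)//=.
apply: eq_bigr => j _.
have gj : g j \in fset_set [set g j | j in [set: J]].
  by rewrite in_fset_set// inE; exists j.
rewrite big_mkcond (bigD1_seq (g j))//= eqxx big1 ?addr0// => c.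
by rewrite eq_sym => /negPf ->.
Qed.

(** * K-finiteness, and isotypic sections over a fixed representative *)

Section KFinite.
Variables (R : realType) (G : topologicalGroupType) (n : nat).
Variables (L : lie_structure R G n) (K : set G).
Hypothesis K_maximal : maximal_compact_subgroup K.
Variables (I : iwasawa L K) (Gamma : set G).
Variables (q : nat) (kappa : G -> 'M[R[i]]_q).
Variables (p : nat) (gamma : G -> 'M[R[i]]_p).
Hypothesis gamma_rep : unitary_rep K gamma.
Local Notation C := R[i].

(** Makes the defining formula of sigma_T applicable to [f]: the entries of f(xk) are bilinear in
    those of gamma(k) and its adjoint, with the entries of f(x) as coefficients. *)
Lemma A_gamma_invariant_Kfinite (f : coset_space Gamma -> 'M[C]_p) :
  A_gamma_invariant K gamma f -> A_gamma_Kfinite K f.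
Proof.
move=> fP; have [cf _] := fP; split=> //.
(* For an index (i, j, a, a') the function is f_(a a') E_(i j), with coefficient the (i, a) entry of
   the adjoint of gamma(k) times gamma(k)_(a' j). *)
pose J := ('I_p * 'I_p * 'I_p * 'I_p)%type.
pose b (t : J) (x : coset_space Gamma) : 'M[C]_p :=
  f x t.1.2 t.2 *: delta_mx t.1.1.1 t.1.1.2.
pose c k (t : J) := (gamma k)^t* t.1.1.1 t.1.2 * gamma k t.2 t.1.1.2.
exists #|{: J}|, (fun l => b (enum_val l)) => k Kk.
exists (fun l => c k (enum_val l)) => x.
rewrite (A_gamma_invariant_act K_maximal gamma_rep x Kk fP).
rewrite -(big_enum_val (fun t => c k t *: b t x)) /=.
transitivity (\sum_(t : J) c k t *: b t x); last by apply: eq_bigl.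
rewrite [LHS]matrix_sum_delta.
rewrite -(pair_bigA _ (fun t1 t2 => c k (t1, t2) *: b (t1, t2) x)) /=.
rewrite -(pair_bigA _ (fun t1 t2 => \sum_t3
  c k (t1, t2, t3) *: b (t1, t2, t3) x)) /=.
rewrite -(pair_bigA _ (fun t1 t2 => \sum_t3 \sum_t4
  c k (t1, t2, t3, t4) *: b (t1, t2, t3, t4) x)) /=.
apply: eq_bigr => i _; apply: eq_bigr => l _.
rewrite mxE exchange_big /= scaler_suml; apply: eq_bigr => a _.
rewrite mxE big_distrl scaler_suml /=; apply: eq_bigr => a' _.
by rewrite /c /b /= scalerA mulrAC.
Qed.

(** Every translate of a column of psi_S is a combination of the p columns of psi_S, with
    coefficients from gamma(k^-1). Convergence along a conveniently arranged sequence thus applies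
    to psi_S. *)
Lemma psi_T_CK S : M_invariant I gamma kappa S ->
  CK_tensor I kappa (psi_T gamma S).
Proof.
move=> SM j.
have SP := psi_T_section K_maximal gamma_rep SM.
have [e c] := continuous_section_col j SP; split=> //.
exists p, (fun a k => col a (psi_T gamma S k)) => k Kk.
exists (fun a => gamma (k^-1)%g j a) => k' Kk'.
have [_ gM _] := gamma_rep.
rewrite /psi_T gM//; last exact: (max_compactV K_maximal).
apply/colP => i; rewrite trmx_mul mulmxA !mxE summxE; apply: eq_bigr => a _.
by rewrite !mxE mulrC.
Qed.

(** [isotypic] may use a different representative of the class for each column; the equivalences
    move all of them to [s], and the columns are reassembled. *)
Lemma isotypic_tensor_decomposition (s : matrix_rep R G)
    (phi : G -> 'M[C]_(q, p)) :
  isotypic_tensor I kappa (rep_class K s) phi ->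
  exists (J : finType) (F : J -> G -> 'M[C]_(q, projT1 s))
         (V : J -> 'M[C]_(projT1 s, p)),
    (forall j, intertwiner I kappa (projT2 s) (F j)) /\
    forall k, K k -> phi k = \sum_j F j k *m V j.
Proof.
move=> phiP.
have /choice[t tP] : forall j : 'I_p, exists t : {m : nat &
    (('I_m -> G -> 'M[C]_(q, projT1 s)) * ('I_m -> 'cV[C]_(projT1 s)))%type},
  (forall l, intertwiner I kappa (projT2 s) ((projT2 t).1 l)) /\
  forall k, K k -> col j (phi k) = \sum_l (projT2 t).1 l k *m (projT2 t).2 l.
  move=> j; have [s' [[_ [P [P' [PP' P'P sP]]]] [m [F [v [FP Fv]]]]]] := phiP j.
  exists (existT _ m (fun l k => F l k *m P, fun l => P' *m v l)) => /=; split.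
    move=> l; have [e c FK] := FP l; split.
    - by move=> k h Kk Mh; rewrite e// mulmxA.
    - by apply: mx_continuous_mul => //; exact: mx_continuous_cst.
    - by move=> k k' Kk Kk'; rewrite FK// -!mulmxA sP.
  move=> k Kk; rewrite Fv//; apply: eq_bigr => l _.
  by rewrite mulmxA -(mulmxA _ P) PP' mulmx1.
(* Pairs of a column j and a term of its decomposition; multiplying the vector by the j-th unit row
   puts it back into column j. *)
exists {j : 'I_p & 'I_(projT1 (t j))},
  (fun u => (projT2 (t (tag u))).1 (tagged u)),
  (fun u => (projT2 (t (tag u))).2 (tagged u) *m delta_mx 0 (tag u)).
split=> [u|k Kk]; first by have [+ _] := tP (tag u); exact.
rewrite -(sig_big_dep xpredT (fun _ => xpredT) (fun j l =>
  (projT2 (t j)).1 l k *m ((projT2 (t j)).2 l *m delta_mx 0 j))).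
transitivity (\sum_j col j (phi k) *m (delta_mx 0 j : 'rV_p)).
  apply/matrixP => a b; rewrite summxE (bigD1 b)//= big1 ?addr0.
    by rewrite !mxE big_ord1 !mxE !eqxx mulr1.
  by move=> j /negPf jb; rewrite !mxE big_ord1 !mxE [b == j]eq_sym jb andbF mulr0.
apply: eq_bigr => j _; have [_ ->//] := tP j.
by rewrite mulmx_suml; apply: eq_bigr => l _; rewrite mulmxA.
Qed.

End KFinite.

(** * The contribution of one K-type *)

Section DeltaComponents.
Variables (R : realType) (G : topologicalGroupType) (n : nat).
Variables (L : lie_structure R G n) (K : set G).
Hypothesis K_maximal : maximal_compact_subgroup K.
Variables (I : iwasawa L K) (Gamma : set G).
Local Notation X := (coset_space Gamma).
Hypothesis Gamma_cocompact : compact [set: X].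
Variable mu : {measure set (borel X) -> \bar R}.
Hypothesis mu_invariant : invariant_measure mu.
Variable haar : {measure set (borel G) -> \bar R}.
Hypothesis haar_K : haar_measure K haar.
Variables (q : nat) (kappa : G -> 'M[R[i]]_q).
Variables (p : nat) (gamma : G -> 'M[R[i]]_p).
Hypothesis gamma_rep : unitary_rep K gamma.
Local Notation C := R[i].

Lemma unitary_rep_conj :
  unitary_rep K (fun k => map_mx (@Num.conj C) (gamma k)).
Proof.
have [gu gM cg] := gamma_rep; split.
- by move=> k Kk; rewrite conjC_unitary; exact: gu.
- by move=> x y Kx Ky; rewrite gM// map_mxM.
- exact: mx_continuous_conj.
Qed.

Section ConjugateDecomposition.
Variables (J : finType) (s : J -> matrix_rep R G).
Variable U : forall j, 'M[C]_(p, projT1 (s j)).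
Hypothesis s_irr : forall j, irreducible_unitary_rep K (projT2 (s j)).
Hypothesis sU : forall j x, K x ->
  map_mx (@Num.conj C) (gamma x) *m U j = U j *m projT2 (s j) x.
Hypothesis sum_U : \sum_j U j *m (U j)^t* = 1%:M.

(** One summand of the resolution of the identity; the isotypic component for a class is the sum
    over all [j] of that class. It acts on the right of T, on the factor V_gamma. *)
Definition isotypic_proj j : 'M[C]_p := U j *m (U j)^t*.

Lemma trgamma_conj k : K k ->
  (gamma k)^T *m map_mx (@Num.conj C) (gamma k) = 1%:M.
Proof.
move=> Kk; have := gamma_adjK gamma_rep Kk => /(congr1 trmx).
by rewrite trmx_mul map_trmx trmxK trmx1.
Qed.

(** As gamma is unitary, gamma(k)^T is the inverse of its conjugate, so this is the relation [sU]
    inverted. *)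
Lemma trgamma_U j k : K k ->
  (gamma k)^T *m U j = U j *m (projT2 (s j) k)^t*.
Proof.
move=> Kk; have [[su _ _] _ _] := s_irr j.
have /unitarymxP ss := su _ Kk.
rewrite -[LHS]mulmx1 -ss mulmxA -(mulmxA _ (U j)) -sU// mulmxA.
by rewrite trgamma_conj// mul1mx.
Qed.

Lemma adjU_trgamma j k : K k ->
  (U j)^t* *m (gamma k)^T = (projT2 (s j) k)^t* *m (U j)^t*.
Proof.
move=> Kk; rewrite -[(gamma k)^T](_ : (map_mx (@Num.conj C) (gamma k))^t* = _).
  by rewrite -!adjM sU.
by apply/matrixP => a b; rewrite !mxE /= conjCK.
Qed.

Lemma isotypic_proj_comm j k : K k ->
  isotypic_proj j *m (gamma k)^T = (gamma k)^T *m isotypic_proj j.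
Proof.
by move=> Kk; rewrite /isotypic_proj -mulmxA adjU_trgamma// !mulmxA trgamma_U.
Qed.

Lemma M_invariant_proj S j : M_invariant I gamma kappa S ->
  M_invariant I gamma kappa (S *m isotypic_proj j).
Proof.
move=> SM h Mh; have Kh := iwa_M_sub Mh.
by rewrite mulmxA -mulmxA isotypic_proj_comm// mulmxA SM.
Qed.

Lemma psi_T_isotypic S j : M_invariant I gamma kappa S ->
  isotypic_tensor I kappa (rep_class K (s j))
    (psi_T gamma (S *m isotypic_proj j)).
Proof.
move=> SM b; exists (s j); split; first exact: rep_class_refl.
have [[su sM sc] _ _] := s_irr j.
have sK : is_subgroup K by have [] := K_maximal.
(* By [trgamma_U] this is psi_S(k) U_j; since the adjoint of s_j(k) is s_j(k^-1), it intertwines s_j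
   with the sections. *)
pose F k := S *m U j *m (projT2 (s j) k)^t*.
have FE k : K k -> psi_T gamma S k *m U j = F k.
  by move=> Kk; rewrite /psi_T /F -!mulmxA trgamma_U.
have [e _] := psi_T_section K_maximal gamma_rep SM.
exists 1, (fun _ => F), (fun _ => col b ((U j)^t* )); split=> [_|k Kk]; first split.
- move=> k h Kk Mh; have Kkh : K (k * h)%g.
    by apply: (max_compactM K_maximal) => //; exact: iwa_M_sub Mh.
  by rewrite -!FE// e// mulmxA.
- apply: mx_continuous_mul; first exact: mx_continuous_cst.
  by apply: mx_continuous_conj; exact: mx_continuous_tr.
- move=> k k' Kk Kk'; have KkV : K (k^-1)%g by exact: (max_compactV K_maximal).
  rewrite /F sM// adjM mulmxA; congr (_ *m _).
  have /unitarymxP E := su _ KkV.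
  have [sV _] := unitary_repV sK (And3 su sM sc) Kk.
  by rewrite -[RHS]mulmx1 -E mulmxA sV mul1mx.
rewrite big_ord1 -col_mulmx; congr (col b _).
by rewrite /psi_T /F /isotypic_proj -!mulmxA adjU_trgamma.
Qed.

Lemma delta_component T (s0 : matrix_rep R G) delta :
  M_invariant I gamma kappa T -> irreducible_unitary_rep K (projT2 s0) ->
  is_delta I haar kappa T (rep_class K s0) delta ->
  continuous_section I kappa delta /\
  forall (lambda : astar I) xi (f : X -> 'M[C]_p),
    unitary_embedding mu haar kappa lambda xi ->
    A_gamma_invariant K gamma f ->
    sigma_xi mu xi (psi_T gamma T) delta f =
    \sum_(j | rep_class K (s j) == rep_class K s0)
      sigma_xi mu xi (psi_T gamma T) (psi_T gamma (T *m isotypic_proj j)) f.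
Proof.
move=> TM irr0 [iso deltaP].
have [A [F [V [FP deltaE]]]] := isotypic_tensor_decomposition iso.
have [ru _ _] := irr0.
have sK : is_subgroup K by have [] := K_maximal.
pose Q a := rep_mean K haar gamma (projT2 s0) (V a).
pose S := \sum_a F a 1%g *m Q a.
have FVP a : continuous_section I kappa (fun k => F a k *m V a).
  by have [e c _] := FP a; exact: continuous_section_mul.
have sumP := continuous_section_sum FVP.
have deltaE' k : K k -> \sum_a F a k *m V a = delta k by move=> /deltaE.
split; first exact: (eq_continuous_section K_maximal deltaE' sumP).
have SM : M_invariant I gamma kappa S.
  move=> h Mh; rewrite mulmx_sumr mulmx_suml; apply: eq_bigr => a _.
  exact: (intertwiner_mean_M_invariant K_maximal haar_K gamma_rep ru (FP a)).
(* Q_a U_j intertwines s_j with s0, so by Schur it vanishes unless the two are equivalent. *)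
have QU a j : rep_class K (s j) <> rep_class K s0 -> Q a *m U j = 0.
  move=> ncls; apply: contra_notP ncls => QU0; apply: rep_class_eq.
  apply: (schur (s_irr j) irr0 _ QU0) => x Kx.
  have QE : Q a *m map_mx (@Num.conj C) (gamma x) = projT2 s0 x *m Q a.
    have rQ := rep_mean_invariant L K_maximal haar_K gamma_rep ru (V a) Kx.
    by rewrite /Q -[in LHS]rQ -mulmxA trgamma_conj// mulmx1.
  by rewrite -mulmxA -sU// !mulmxA QE.
have SU j : S *m U j = if rep_class K (s j) == rep_class K s0 then T *m U j else 0.
  case: eqP => [cls|ncls]; last first.
    rewrite mulmx_suml big1// => a _.
    by rewrite -mulmxA QU// mulmx0.
  (* Testing [delta] against [psi_D] gives [||(S - T) U_j||^2 = 0]. *)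
  pose D := (S - T) *m isotypic_proj j.
  have STM : M_invariant I gamma kappa (S - T).
    by move=> h Mh; rewrite mulmxBr mulmxBl SM// TM.
  have DM : M_invariant I gamma kappa D by exact: M_invariant_proj.
  have isoD : isotypic_tensor I kappa (rep_class K s0) (psi_T gamma D).
    by rewrite -cls; exact: psi_T_isotypic.
  have gamma1 := unitary_rep1 sK gamma_rep.
  have psiP := psi_T_section K_maximal gamma_rep DM.
  have ci a : cplx_integrable haar (K : set (borel G))
      (fun k => mxdot (psi_T gamma D k) (F a k *m V a)).
    apply: (max_compact_integrable L K_maximal haar_K).
    by apply: mx_continuous_mxdot; [exact: psiP.2|exact: (FVP a).2].
  have mK := max_compact_measurable L K_maximal.
  have mxdot_sumr (A' : 'M[C]_(q, p)) (B : A -> 'M[C]_(q, p)) :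
      mxdot A' (\sum_a B a) = \sum_a mxdot A' (B a).
    rewrite mxdotE mulmx_sumr linear_sum; apply: eq_bigr => a _.
    by rewrite [RHS]mxdotE.
  (* Both sides equal the pairing of delta with psi_D: the right one by definition of delta, as
     psi_D(1) = D, the left one by averaging. The conjugates arise because the averaging lemma has
     psi_D as first argument. *)
  have SD : mxdot S D = mxdot T D.
    have := deltaP _ isoD.
    rewrite [psi_T gamma D 1%g]/psi_T gamma1 trmx1 mulmx1 => <-.
    rewrite mxdotJ mxdot_sumr.
    transitivity (\sum_a cint haar K (fun k : borel G =>
        mxdot (psi_T gamma D k) (F a k *m V a)))^*.
      congr (_^*); apply: eq_bigr => a _.
      by rewrite (cint_intertwiner_mean K_maximal haar_K gamma_rep ru (FP a)).
    rewrite -(cint_sum mK ci) -(cintJ mK (cplx_integrable_sum mK ci)).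
    by apply: eq_cint => k Kk; rewrite -mxdot_sumr -deltaE// -mxdotJ.
  apply/eqP; rewrite -subr_eq0 -mulmxBl; apply/eqP; apply: mxdot_eq0.
  have := mxdotMr (S - T) ((S - T) *m U j) ((U j)^t* ).
  by rewrite adjK -mulmxA => <-; rewrite mxdotBl SD subrr.
have psiSE k : psi_T gamma S k =
    \sum_(j | rep_class K (s j) == rep_class K s0)
      psi_T gamma (T *m isotypic_proj j) k.
  rewrite /psi_T -mulmx_suml; congr (_ *m _).
  rewrite -[S]mulmx1 -sum_U mulmx_sumr [RHS]big_mkcond; apply: eq_bigr => j _.
  by rewrite mulmxA SU; case: ifP => _; rewrite ?mul0mx// -mulmxA.
move=> lambda xi f xiP fP; have [cf _] := fP.
have TP := psi_T_section K_maximal gamma_rep TM.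
have FQP a : continuous_section I kappa (fun k => F a k *m Q a).
  by have [e c _] := FP a; exact: continuous_section_mul.
have TjP j := psi_T_section K_maximal gamma_rep (M_invariant_proj j TM).
rewrite -(sigma_xi_sum K_maximal Gamma_cocompact haar_K xiP _ cf TP TjP).
transitivity (sigma_xi mu xi (psi_T gamma T) (fun k => \sum_a F a k *m V a) f).
  apply/esym.
  by apply: (eq_sigma_xi K_maximal Gamma_cocompact haar_K xiP cf TP sumP).
(* The V_a may be replaced by their means, since psi_T and f are K-invariant; the new sum is psi_S
   on K. *)
transitivity (sigma_xi mu xi (psi_T gamma T) (fun k => \sum_a F a k *m Q a) f).
  rewrite (sigma_xi_sum K_maximal Gamma_cocompact haar_K xiP _ cf TP FVP).
  rewrite (sigma_xi_sum K_maximal Gamma_cocompact haar_K xiP _ cf TP FQP).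
  apply: eq_bigr => a _.
  exact: (sigma_xi_intertwiner_mean K_maximal Gamma_cocompact mu_invariant
    haar_K gamma_rep xiP _ fP TM ru (FP a)).
apply: (eq_sigma_xi K_maximal Gamma_cocompact haar_K xiP cf TP
  (continuous_section_sum FQP)) => // k Kk.
rewrite -psiSE /psi_T mulmx_suml; apply: eq_bigr => a _.
exact: (intertwiner_meanE K_maximal haar_K gamma_rep ru (FP a)).
Qed.

End ConjugateDecomposition.
End DeltaComponents.

(** * Passage to the limit *)

Theorem proposition3p16
  (R : realType)
  (G : topologicalGroupType) (n : nat) (L : lie_structure R G n)
  (G_semisimple : semisimple L)
  (K : set G) (K_maximal : maximal_compact_subgroup K)
  (I : iwasawa L K)
  (Gamma : set G) (Gamma_discrete : discrete_subgroup Gamma)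
  (Gamma_torsion_free : torsion_free Gamma)
  (Gamma_cocompact : compact [set: coset_space Gamma])
  (mu : {measure set (borel (coset_space Gamma)) -> \bar R})
  (mu_invariant : invariant_measure mu)
  (haar : {measure set (borel G) -> \bar R})
  (haar_K : haar_measure K haar)
  (p : nat) (gamma : G -> 'M[R[i]]_p) (gamma_rep : unitary_rep K gamma)
  (q : nat) (kappa : G -> 'M[R[i]]_q)
  (kappa_irr : irreducible_unitary_rep (iwa_M I) kappa)
  (l : astar I) (l_limit : L_kappa mu haar kappa l) (l_regular : regular l)
  (T : 'M[R[i]]_(q, p)) (T_invariant : M_invariant I gamma kappa T)
  (T_unit : mxdot T T = 1)
  (lambda : nat -> astar I)
  (xi : nat -> (G -> 'cV[R[i]]_q) -> coset_space Gamma -> R[i])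
  (xi_arranged : conveniently_arranged mu haar p kappa l lambda xi)
  (delta : set (matrix_rep R G) -> G -> 'M[R[i]]_(q, p))
  (delta_T : forall c, unitary_dual R K c ->
     is_delta I haar kappa T c (delta c))
  (sigma_T : (coset_space Gamma -> 'M[R[i]]_p) -> R[i])
  (sigma_TP : is_sigma_T K mu gamma xi T delta sigma_T) :
  forall f : coset_space Gamma -> 'M[R[i]]_p,
    A_gamma_invariant K gamma f ->
    cvgC (fun j => sigma_vect mu (xi_tensor (xi j) (psi_T gamma T)) f)
      (sigma_T f).
Proof.
move=> f fP; have [cf _] := fP.
have [[xiP _ _] _ conv] := xi_arranged.
have [_ sigma_TE] := sigma_TP.
have [J [s [U [s_irr sU sum_U]]]] :=
  unitary_rep_decomposition (unitary_rep_conj gamma_rep).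
pose P := isotypic_proj U.
have TPM j : M_invariant I gamma kappa (T *m P j).
  exact: (M_invariant_proj gamma_rep s_irr sU j T_invariant).
have TS := psi_T_section K_maximal gamma_rep T_invariant.
have TPS j := psi_T_section K_maximal gamma_rep (TPM j).
(* Each component T P_j has its own limit, by the convenient arrangement of the sequence. *)
have /choice[z zP] : forall j, exists z : R[i],
    cvgC (fun k => sigma_xi mu (xi k) (psi_T gamma T) (psi_T gamma (T *m P j)) f) z.
  by move=> j; apply: conv => //; exact: (psi_T_CK K_maximal gamma_rep).
have -> : sigma_T f = \sum_j z j.
  rewrite (sigma_TE _ (A_gamma_invariant_Kfinite K_maximal gamma_rep fP)).
  rewrite -(fsbig_fibers (D := unitary_dual R K) (g := fun j => rep_class K (s j))).
    (* The limit defining the term of class c exists: the sequence equals a finite sum of the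
       convergent sequences of the components in that class. *)
    apply: eq_fsbigr => c /set_mem cK; apply: cvgC_lim.
    have := delta_T _ cK; have [s0 irr0 ->] := unitary_dualP cK => deltaP.
    have [_ deltaE] := delta_component K_maximal Gamma_cocompact mu_invariant haar_K
      gamma_rep s_irr sU sum_U T_invariant irr0 deltaP.
    under eq_fun do rewrite (deltaE _ _ _ (xiP _) fP).
    exact: cvgC_sum.
  by move=> j; exact: rep_class_dual.
have sum_TP : psi_T gamma T = (fun k => \sum_j psi_T gamma (T *m P j) k).
  apply/funext => k; rewrite /psi_T -mulmx_suml -mulmx_sumr.
  by rewrite /P /isotypic_proj sum_U mulmx1.
(* The vector state of psi_T is [sigma_xi] with both arguments psi_T; only the second one is
   decomposed. *)
rewrite (_ : (fun j => _) = (fun k => \sum_j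
    sigma_xi mu (xi k) (psi_T gamma T) (psi_T gamma (T *m P j)) f)).
  exact: cvgC_sum.
apply/funext => k.
rewrite -(sigma_xi_sum K_maximal Gamma_cocompact haar_K (xiP k) _ cf TS TPS).
by rewrite -sum_TP.
Qed.
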